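(* Let $T$ be a binary tree on $n\geq 12$ vertices. Let $l$ be the smallest positive odd integer such that $f_{T_{rg}^{l}}(r)>3\times 2^{\frac{n-l-1}{2}}-2$, where $r$ denotes the root of the rooted binary tree $T_{rg}^{l}$. Then $$d_T(C(T),S_c(T))\leq d_{T_{rg}^{n,l}}\big(C(T_{rg}^{n,l}),S_c(T_{rg}^{n,l})\big).$$
   Context: All graphs are finite, simple, connected and undirected. A pendant vertex is a vertex of degree $1$. A binary tree is a tree in which every non-pendant vertex has degree $3$ (so its number of vertices is even). Center and subtree core: the eccentricity of $v\in V(T)$ is $e(v)=\max_{u}d_T(u,v)$; the center $C(T)$ is the set of vertices of minimum eccentricity. A subtree of $T$ is a (nonempty) connected subgraph of $T$; $f_T(v)$ is the number of subtrees of $T$ containing $v$; the subtree core $S_c(T)$ is the set of vertices $v$ for which $f_T(v)$ is maximum. For $X,Y\subseteq V(T)$, $d_T(X,Y)=\min\{d_T(x,y):x\in X,y\in Y\}$. Rooted binary trees: a rooted binary tree is a rooted tree whose root has degree $2$ and in which every other vertex has degree $1$ or $3$; the single-vertex rooted tree is also allowed. The height (level) of a vertex is its distance to the root. A rooted binary tree is ordered if the vertices of each level $l\ge 1$ are linearly ordered so that two vertices at level $l+1$ with different parents are ordered as their parents are at level $l$. A rooted binary tree is rgood if (i) the heights of any two of its pendant vertices differ by at most $1$, and (ii) it can be ordered so that the parents of the pendant vertices at the highest level form a final segment in the ordering of the vertices at the next-to-highest level. For each odd $l$ there is, up to isomorphism, exactly one rgood binary tree on $l$ vertices, denoted $T_{rg}^l$.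 Crg trees: a binary caterpillar is a binary tree having a path such that every vertex not on the path is adjacent to a vertex of the path. For even $n\ge 4$ and odd $l$ with $3\le l<n$, the crg tree $T_{rg}^{n,l}$ is the tree on $n$ vertices obtained by identifying the root of $T_{rg}^l$ with a vertex of maximum eccentricity of a binary caterpillar on $n-l+1$ vertices. *)

(* Defs.v *)
From mathcomp Require Import all_boot.

Set Implicit Arguments.
Unset Strict Implicit.
Unset Printing Implicit Defensive.

Record sgraph := SGraph {
  vertex :> finType;
  adj : rel vertex;
  adj_sym : symmetric adj;
  adj_irr : irreflexive adj }.

Section Graph.
Variable G : sgraph.
Implicit Types (u v w x y : G) (X Y : {set G}).

Definition degree v := #|[set w | adj v w]|.

Definition pendant v := degree v == 1.

Definition connected := forall x y, connect (@adj G) x y.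

(* A 2-cycle in the sense of [ucycle] only runs back and forth along an edge. *)
Definition acyclic := forall c : seq G, ucycle (@adj G) c -> size c < 3.

Definition tree := connected /\ acyclic.

Definition has_walk k x y :=
  [exists p : k.-tuple G, path (@adj G) x p && (last x p == y)].

(* The default value #|G| is only reached when x and y are not connected. *)
Definition dist x y : nat :=
  \big[minn/#|G|]_(k < #|G| | has_walk k x y) (k : nat).

(* The default value #|G| is only reached when X or Y is empty or when no
   vertex of X is connected to a vertex of Y. *)
Definition set_dist X Y : nat :=
  \big[minn/#|G|]_(x in X) \big[minn/#|G|]_(y in Y) dist x y.

Definition ecc v := \max_(u : G) dist u v.

Definition center := [set v | [forall u, ecc v <= ecc u]].

(* A subgraph is given by its vertex set and its edge set; an edge {x, y} is
   represented by the two ordered pairs (x, y) and (y, x). *)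
Definition is_subgraph (H : {set G} * {set G * G}) :=
  [forall x, forall y, ((x, y) \in H.2) ==>
    [&& adj x y, x \in H.1, y \in H.1 & (y, x) \in H.2]].

Definition is_subtree (H : {set G} * {set G * G}) :=
  [&& is_subgraph H, H.1 != set0 &
    [forall x in H.1, forall y in H.1,
      connect (fun a b => (a, b) \in H.2) x y]].

Definition nb_subtrees v := #|[set H | is_subtree H & v \in H.1]|.

Definition subtree_core :=
  [set v | [forall u, nb_subtrees u <= nb_subtrees v]].

Definition binary_tree := tree /\ forall v, ~~ pendant v -> degree v = 3.

Definition binary_caterpillar :=
  binary_tree /\
  exists (x : G) (p : seq G),
    [/\ path (@adj G) x p, uniq (x :: p) &
        forall v, v \notin x :: p -> exists2 w, w \in x :: p & adj v w].

Section Rooted.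
Variable r : G.

Definition rooted_binary_tree :=
  tree /\
  (#|G| = 1 \/
   degree r = 2 /\ forall v, v != r -> degree v = 1 \/ degree v = 3).

Definition height v := dist r v.

Definition level k := [set v | height v == k].

Definition is_parent u v := adj u v && (height v == (height u).+1).

(* Only the restrictions of [le] to the levels k >= 1 are relevant. *)
Definition is_ordering (le : rel G) :=
  forall k, 0 < k ->
    [/\ {in level k &, total le},
        {in level k &, antisymmetric le},
        {in level k & &, transitive le} &
        {in level k.+1 &, forall x y, forall px py,
           is_parent px x -> is_parent py y -> px != py ->
           le x y = le px py}].

Definition max_height := \max_(v : G) height v.

Definition parents_of_deepest :=
  [set u | [exists v, [&& pendant v, height v == max_height & is_parent u v]]].

Definition rgood :=
  [/\ rooted_binary_tree,
      forall u v, pendant u -> pendant v -> height u <= (height v).+1 &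
      exists2 le : rel G, is_ordering le &
        {in level max_height.-1 &, forall x y,
           x \in parents_of_deepest -> le x y -> y \in parents_of_deepest}].

Definition is_Trg (l : nat) := rgood /\ #|G| = l.

End Rooted.
End Graph.

Arguments binary_tree G : clear implicits.
Arguments binary_caterpillar G : clear implicits.
Arguments center G : clear implicits.
Arguments subtree_core G : clear implicits.

(* The graph obtained from the disjoint union of C and R by identifying the
   vertex r of R with the vertex u of C: the merged vertex is [inl u]. *)
Section Identify.
Variables (C R : sgraph) (u : C) (r : R).

Definition identify_vertex : finType := (C + {x : R | x != r})%type.

Definition identify_adj (a b : identify_vertex) : bool :=
  match a, b with
  | inl x, inl y => adj x y
  | inr x, inr y => adj (val x) (val y)
  | inl x, inr y => (x == u) && adj r (val y)
  | inr x, inl y => (y == u) && adj r (val x)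
  end.

Lemma identify_sym : symmetric identify_adj.
Proof. by move=> [x|x] [y|y] //=; rewrite adj_sym. Qed.

Lemma identify_irr : irreflexive identify_adj.
Proof. by move=> [x|x] /=; rewrite adj_irr. Qed.

Definition identify := SGraph identify_sym identify_irr.
End Identify.

Inductive is_crg (n l : nat) : sgraph -> Prop :=
  IsCrg (C R : sgraph) (u : C) (r : R) of
    ~~ odd n & 4 <= n & odd l & 3 <= l < n &
    binary_caterpillar C & #|C| = n - l + 1 &
    (forall v : C, ecc v <= ecc u) & is_Trg r l :
  is_crg n l (identify u r).

(* Since T_rg^l exists for each odd l and is unique up to isomorphism, the
   existential quantifier could equivalently be a universal one.  Here n is
   even; the truncated exponent, for l > n, does not change the truth value. *)
Definition Trg_exceeds (n l : nat) :=
  exists (R : sgraph) (r : R),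
    is_Trg r l /\ 3 * 2 ^ ((n - l - 1) %/ 2) - 2 < nb_subtrees r.

(* Main.v *)
(* Let c be a vertex of the center and s one of the subtree core of T with
   d = d(c, s) minimal.  The edge at s towards c splits T into a branch A
   containing c and a branch B containing s.  As the neighbour of s is not in
   the core, B has more subtrees containing its root than A; a rooted binary
   tree with k internal vertices has at least 3 * 2^k - 2 such subtrees (the
   caterpillar) and at most as many as the rgood tree, so |B| >= l.  As the
   neighbour of c towards s is not in the center, the height of A is at least
   2d - 1 plus the height of B, which bounds (n - l - 1) / 2 from below by
   2d - 1 plus the height of the rgood tree.  In the crg tree the choice of l
   pushes the core into the rgood part, and under this bound the center stays
   at distance at least d from that part.

   That the rgood tree is optimal is an exchange argument.  The largest number
   of subtrees containing the root, plus one, over k internal vertices satisfies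
   opt (k + 1) = 1 + max (opt i * opt (k - i)), and the maximum is attained by
   the pairs (i, k - i) that occur in an rgood tree. *)
Require Import Defs.
From mathcomp Require Import all_boot.
From mathcomp Require Import zify.

Set Implicit Arguments.
Unset Strict Implicit.
Unset Printing Implicit Defensive.

(** * Optimal numbers of subtrees *)

(** The recursion for [opt] uses all earlier values, so the list of the values at 0, ..., n is
    built. *)
Fixpoint opt_seq n : seq nat :=
  if n is m.+1 then
    let s := opt_seq m in
    rcons s (\max_(i < n) nth 0 s i * nth 0 s (m - i)).+1
  else [:: 2].

(* One plus the largest number of subtrees containing the root, over the rooted
   binary trees with k internal vertices. *)
Definition opt k := nth 0 (opt_seq k) k.

Lemma size_opt_seq n : size (opt_seq n) = n.+1.
Proof. by elim: n => // n IHn; rewrite size_rcons IHn. Qed.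

Lemma nth_opt_seq n k : k <= n -> nth 0 (opt_seq n) k = opt k.
Proof.
elim: n => [|n IHn]; first by rewrite leqn0 => /eqP->.
rewrite leq_eqVlt => /predU1P[->//|le_kn].
by rewrite /= nth_rcons size_opt_seq le_kn IHn.
Qed.

Lemma optS n : opt n.+1 = (\max_(i < n.+1) opt i * opt (n - i)).+1.
Proof.
rewrite /opt /= nth_rcons size_opt_seq ltnn eqxx; congr _.+1.
by apply: eq_bigr => i _; rewrite !nth_opt_seq ?leq_subr // -ltnS.
Qed.

Lemma opt_mul i j : opt i * opt j < opt (i + j).+1.
Proof.
rewrite optS ltnS.
have lt_i : i < (i + j).+1 by rewrite ltnS leq_addr.
have := leq_bigmax (F := fun i0 : 'I_(i + j).+1 => opt i0 * opt (i + j - i0)).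
by move=> /(_ (Ordinal lt_i)); rewrite /= addKn.
Qed.

Lemma leq_opt i j : i <= j -> opt i <= opt j.
Proof.
elim: j => [|j IHj]; first by rewrite leqn0 => /eqP->.
rewrite leq_eqVlt => /predU1P[->//|le_ij]; apply: leq_trans (IHj le_ij) _.
have := opt_mul 0 j; rewrite add0n (_ : opt 0 = 2) //; lia.
Qed.

(* The pairs of numbers of internal vertices of the two branches at a vertex
   of an rgood tree whose branches have their leaves at depth g or g + 1. *)
Variant balanced u v : Prop := Balanced g of
  2 ^ g <= u.+1 <= 2 ^ g.+1 & 2 ^ g <= v.+1 <= 2 ^ g.+1 &
  [|| u.+1 == 2 ^ g, u.+1 == 2 ^ g.+1, v.+1 == 2 ^ g | v.+1 == 2 ^ g.+1].

Lemma balanced_exists s :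
  exists u v, [/\ balanced u v, u + v = s & v <= u].
Proof.
pose g := trunc_log 2 (s./2).+1.
have := @trunc_log_bounds 2 (s./2).+1 isT isT; rewrite /= -/g expnS.
have := expn_gt0 2 g; rewrite /=; set Q := 2 ^ g => Q0 HQ.
(* The smaller part is Q - 1 as long as the rest stays at most 2Q - 1, that is s <= 3Q - 2; beyond
   that the larger part is 2Q - 1. *)
have [le_s|lt_s] := leqP s (3 * Q - 2).
  exists (s - Q.-1), Q.-1; split; try lia.
  by exists g; rewrite ?expnS -/Q; lia.
exists (2 * Q).-1, (s - (2 * Q).-1); split; try lia.
by exists g; rewrite ?expnS -/Q; lia.
Qed.

(** At distinct scales the two ranges share at most one value, and equal sums force all four numbers
    to it. At equal scales one part is an end of the range, and the sum fixes the pair up to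
    order. *)
Lemma balanced_uniq u v u' v' : balanced u v -> balanced u' v' ->
  u + v = u' + v' -> (u = u' /\ v = v') \/ (u = v' /\ v = u').
Proof.
case=> g Hu Hv H [g' Hu' Hv' H'] E.
have [lt_gg|lt_gg|eq_gg] := ltngtP g g'.
- have : 2 ^ g.+1 <= 2 ^ g' by rewrite leq_exp2l.
  by move: Hu Hv H Hu' Hv' H'; rewrite !expnS; lia.
- have : 2 ^ g'.+1 <= 2 ^ g by rewrite leq_exp2l.
  by move: Hu Hv H Hu' Hv' H'; rewrite !expnS; lia.
by move: Hu Hv H Hu' Hv' H'; rewrite -eq_gg !expnS; lia.
Qed.

Lemma balanced_opt_uniq u v u' v' : balanced u v -> balanced u' v' ->
  u + v = u' + v' -> opt u * opt v = opt u' * opt v'.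
Proof.
move=> B B' E; have [[-> ->]|[-> ->]] := balanced_uniq B B' E => //.
exact: mulnC.
Qed.

(** Expanding (x' - x)(x' - y) >= 0 gives x'(x + y) <= x'(x' + y'); for x' = 0 both x and y
    vanish. *)
Lemma leq_sum_of_prod x y x' y' :
  x <= x' -> y <= x' -> x * y <= x' * y' -> x + y <= x' + y'.
Proof. by nia. Qed.

Lemma leq_mulSS a b c d : a * b <= c * d -> a + b <= c + d ->
  a.+1 * b.+1 <= c.+1 * d.+1.
Proof. by rewrite !mulSn !mulnS; lia. Qed.

Lemma exchange_le p q a b : p <= q -> a <= b -> q * a + p * b <= q * b + p * a.
Proof. by move=> /subnKC<- /subnKC<-; nia. Qed.

(* Strong induction on the sum of the pair, then on its larger element: every
   unbalanced pair is improved by an exchange of branches. *)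
Lemma balanced_opt i j u v : balanced u v -> i + j = u + v ->
  opt i * opt j <= opt u * opt v.
Proof.
(* All balanced pairs with a given sum have the same product, so one good pair suffices. *)
suff [u' [v' [Buv' Euv' le_ij]]] : exists u' v',
    [/\ balanced u' v', u' + v' = i + j & opt i * opt j <= opt u' * opt v'].
  by move=> Buv Eij; rewrite -(balanced_opt_uniq Buv' Buv) ?Euv'.
clear u v; move Es: (i + j) => s; elim/ltn_ind: s i j Es => s IHs.
have IH i j u v : i + j < s -> balanced u v -> i + j = u + v ->
    opt i * opt j <= opt u * opt v.
  move=> lt_s Buv Eij; have [u' [v' [Buv' Euv' le_ij]]] := IHs _ lt_s _ _ erefl.
  by rewrite -(balanced_opt_uniq Buv' Buv) ?Euv'.
(* For smaller sums the claim is known, so the maximum in [optS] is attained at the balanced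
   split. *)
have opt_split k u v : k <= s -> balanced u v -> k = (u + v).+1 ->
    opt k = (opt u * opt v).+1.
  move=> le_ks Buv Ek; rewrite Ek optS; congr _.+1; apply/eqP; rewrite eqn_leq.
  apply/andP; split; last by have := opt_mul u v; rewrite optS.
  apply/bigmax_leqP => -[i lt_i] _ /=; apply: IH => //; rewrite subnKC //.
  lia.
suff: forall m i j, i <= m -> j <= i -> i + j = s -> exists u' v',
    [/\ balanced u' v', u' + v' = s & opt i * opt j <= opt u' * opt v'].
  move=> W i j Es.
  have [le_ji|/ltnW le_ij] := leqP j i; first exact: (W i).
  by rewrite mulnC; apply: (W j) => //; rewrite addnC.
elim=> [|m IHm] i j le_im le_ji Es.
  exists 0, 0; have [-> ->] : i = 0 /\ j = 0 by lia.
  by split=> //; [exists 0 | lia].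
have [i0|i_gt0] := posnP i.
  exists 0, 0; have -> : j = 0 by lia.
  by rewrite i0; split=> //; [exists 0 | lia].
(* The larger branch i is split optimally into i1 >= i2; the exchanges below regroup these with j or
   its parts. *)
have [i1 [i2 [Bi Ei le_i]]] := balanced_exists i.-1.
have Oi : opt i = (opt i1 * opt i2).+1 by apply: opt_split => //; lia.
(* If j < i1, swapping them gives the pair (i1, i2 + j + 1): the product does not drop and both
   elements are below i, so the inner induction applies. *)
have [lt_j1|le_1j] := ltnP j i1.
  have [u [v [Buv Euv le_uv]]] : exists u' v', [/\ balanced u' v', u' + v' = s
      & opt i1 * opt (i2 + j).+1 <= opt u' * opt v'].
    have [le1|/ltnW le1] := leqP (i2 + j).+1 i1; first by apply: IHm; lia.
    by rewrite mulnC; apply: IHm; lia.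
  exists u, v; split=> //; apply: leq_trans le_uv; rewrite Oi.
  have := opt_mul i2 j; have := leq_opt (ltnW lt_j1); nia.
case: Bi => g Hi1 Hi2 Hend.
set Q := 2 ^ g in Hi1 Hi2 Hend *; set P := Q.-1.
have Q0 : 0 < Q by rewrite expn_gt0.
rewrite expnS -/Q in Hi1 Hi2 Hend.
have Bmk u v : Q <= u.+1 <= 2 * Q -> Q <= v.+1 <= 2 * Q ->
    [|| u.+1 == Q, u.+1 == 2 * Q, v.+1 == Q | v.+1 == 2 * Q] -> balanced u v.
  by move=> ? ? ?; exists g; rewrite ?expnS.
have Bmk2 u v : 2 * Q <= u.+1 <= 4 * Q -> 2 * Q <= v.+1 <= 4 * Q ->
  [|| u.+1 == 2 * Q, u.+1 == 4 * Q, v.+1 == 2 * Q | v.+1 == 4 * Q] ->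
  balanced u v.
  by move=> ? ? ?; exists g.+1; rewrite ?expnS -/Q; lia.
(* Rebalancing within the scale Q: the larger new part dominates both old ones. *)
have Bext x y : Q <= x.+1 <= 2 * Q -> Q <= y.+1 <= 2 * Q ->
    exists x' y', [/\ balanced x' y', x' + y' = x + y,
      x <= x' /\ y <= x', Q <= x'.+1 <= 2 * Q /\ Q <= y'.+1 <= 2 * Q
      & x'.+1 == 2 * Q \/ y'.+1 == Q].
  move=> Hx Hy; have [le_xy|lt_xy] := leqP (x + y + 2) (3 * Q).
    exists (x + y - P), P; split; try (apply: Bmk); rewrite /P; lia.
  exists (2 * Q).-1, (x + y - (2 * Q).-1); split; try (apply: Bmk); lia.
have [i2P|i2NP] := eqVneq i2.+1 Q.
  (* Here i2 has the least value Q - 1. If j is still in the range, (j, i1) is rebalanced and i2 is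
     joined to the smaller part. *)
  have [le_j|lt_j] := leqP j.+1 (2 * Q).
    have [||x [y [Bxy Exy [le_jx le_1x] [Hx Hy] H]]] := Bext j i1; try lia.
    exists x, (y + P).+1; split; [|rewrite /P; lia|].
      by case: H => H; [apply: Bmk2 | apply: Bmk]; rewrite /P; lia.
    have le_xy : opt j * opt i1 <= opt x * opt y by apply: IH => //; lia.
    have -> : P = i2 by rewrite /P; lia.
    rewrite Oi; have := opt_mul y i2; have := leq_opt le_jx; nia.
  (* Otherwise the optimal split of j also contains i2, and the two copies of i2 are put
     together. *)
  have Oj : opt j = (opt (j.-1 - i2) * opt i2).+1.
    by apply: opt_split; [lia | apply: Bmk; lia | lia].
  exists (i1 + (j.-1 - i2)).+1, (i2 + i2).+1; split; try lia.
    by apply: Bmk2; lia.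
  rewrite Oi Oj; have := opt_mul i2 i2; have := opt_mul i1 (j.-1 - i2).
  have : opt i2 <= opt i1 by apply: leq_opt.
  have : opt i2 <= opt (j.-1 - i2) by apply: leq_opt; lia.
  move: (opt i1) (opt i2) (opt (_ - _)) => a p b pb pa ab pp.
  apply: (@leq_trans ((a * b).+1 * (p * p).+1)); last exact: leq_mul.
  apply: leq_mulSS; first by rewrite mulnACA.
  by have := exchange_le pa pb; rewrite (mulnC b p).
(* As i2 <= i1 and i2 is not Q - 1, the end condition of the balanced pair forces i1 = 2Q - 1. *)
have i1Q : i1.+1 = 2 * Q by lia.
(* For large j the optimal split of j also contains i1, and the two copies of i1 are put
   together. *)
have [le_j|lt_j] := leqP (3 * Q - 2) j.-1.
  have Oj : opt j = (opt i1 * opt (j.-1 - i1)).+1.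
    by apply: opt_split; [lia | apply: Bmk; lia | lia].
  exists (i1 + i1).+1, (i2 + (j.-1 - i1)).+1; split; try lia.
    by apply: Bmk2; lia.
  rewrite Oi Oj; have := opt_mul i1 i1; have := opt_mul i2 (j.-1 - i1).
  have : opt i2 <= opt i1 by apply: leq_opt.
  have : opt (j.-1 - i1) <= opt i1 by apply: leq_opt; lia.
  move: (opt i1) (opt i2) (opt (_ - _)) => q a b bq aq ab qq.
  apply: (@leq_trans ((q * q).+1 * (a * b).+1)); last exact: leq_mul.
  apply: leq_mulSS; first by rewrite mulnACA.
  by have := exchange_le bq aq; rewrite (mulnC b q) (mulnC b a); lia.
(* For small j the optimal split contains P = Q - 1. The other part and i2 are rebalanced, and the
   larger result is joined to i1. *)
have Oj : opt j = (opt P * opt (j.-1 - P)).+1.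
  by apply: opt_split; rewrite /P; [lia | apply: Bmk; lia | lia].
have [||x [y [Bxy Exy [le_2x le_jx] [Hx Hy] H]]] := Bext i2 (j.-1 - P);
  try by rewrite /P; lia.
exists (i1 + x).+1, (P + y).+1; split; [|rewrite /P in Exy *; lia|].
  by case: H => H; apply: Bmk2; rewrite /P; lia.
have le_xy : opt i2 * opt (j.-1 - P) <= opt x * opt y by apply: IH => //; lia.
have le_sum := leq_sum_of_prod (leq_opt le_2x) (leq_opt le_jx) le_xy.
have le_x := leq_opt le_2x.
have le_pq : opt P <= opt i1 by apply: leq_opt; rewrite /P; lia.
apply: leq_trans (leq_mul (opt_mul _ _) (opt_mul _ _)); rewrite Oi Oj.
move: (opt i1) (opt P) (opt i2) (opt (_ - _)) (opt x) (opt y)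
  le_xy le_sum le_x le_pq => q p a b x' y' le_xy le_sum le_x le_pq.
apply: leq_mulSS; first by rewrite mulnACA [leqRHS]mulnACA leq_mul.
(* The gain x' - a carries the larger weight q and, by [le_sum], is at least the loss b - y'. *)
move: le_pq le_x le_sum => /subnKC<- /subnKC<-; nia.
Qed.

(** * Binary trees as terms *)

Inductive btree := Leaf | Node of btree & btree.

Fixpoint internal t := if t is Node a b then (internal a + internal b).+1 else 0.

Fixpoint bheight t :=
  if t is Node a b then (maxn (bheight a) (bheight b)).+1 else 0.

(* Number of subtrees containing the root. *)
Fixpoint bcount t := if t is Node a b then (bcount a).+1 * (bcount b).+1 else 1.

Lemma bcount_opt t : bcount t < opt (internal t).
Proof.
elim: t => //= a IHa b IHb; apply: leq_trans (opt_mul _ _).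
by rewrite ltnS leq_mul.
Qed.

(** With x and y the powers of 2 for the two branches, the induction step has slack (3x - 1)(3y - 1)
    - (6xy - 2) = 3(x - 1)(y - 1). *)
Lemma bcount_lower t : 3 * 2 ^ internal t <= bcount t + 2.
Proof.
elim: t => //= a IHa b IHb; rewrite expnS expnD.
have := expn_gt0 2 (internal a); have := expn_gt0 2 (internal b) => /=.
move: (2 ^ _) (2 ^ _) IHa IHb => x y; nia.
Qed.

Lemma bheight_internal t : bheight t <= internal t.
Proof. by elim: t => //= a IHa b IHb; lia. Qed.

(** A height this large forces a leaf as one branch of every internal vertex, which is the equality
    case of [bcount_lower]. *)
Lemma bcount_caterpillar t : internal t <= bheight t ->
  bcount t + 2 <= 3 * 2 ^ internal t.
Proof.
elim: t => //= a IHa b IHb.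
have := bheight_internal a; have := bheight_internal b => hb ha le_t.
have [[a0 le_b]|[b0 le_a]] : (internal a = 0 /\ internal b <= bheight b) \/
    (internal b = 0 /\ internal a <= bheight a) by lia.
  have -> : a = Leaf by case: (a) a0.
  by have := IHb le_b; rewrite /= add0n expnS; lia.
have -> : b = Leaf by case: (b) b0.
by have := IHa le_a; rewrite /= addn0 expnS; lia.
Qed.

Lemma internal_lt t : (internal t).+1 <= 2 ^ bheight t.
Proof.
elim: t => //= a IHa b IHb; rewrite expnS mul2n -addnn -addSn -addnS.
by rewrite leq_add // (leq_trans IHa, leq_trans IHb) // leq_exp2l // leq_max
  leqnn ?orbT.
Qed.

(** * Distances *)

Section BigMin.
Variables (I : finType) (m : nat).
Implicit Types (P : pred I) (F : I -> nat).

Lemma bigminn_le P F i : P i -> \big[minn/m]_(j | P j) F j <= F i.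
Proof.
move=> Pi; have := mem_index_enum i; elim: (index_enum I) => //= j r IHr.
rewrite in_cons big_cons => /predU1P[<-|/IHr le_r]; first by rewrite Pi geq_minl.
by case: ifP => _ //; rewrite geq_min le_r orbT.
Qed.

Lemma bigminn_ge P F d : d <= m -> (forall i, P i -> d <= F i) ->
  d <= \big[minn/m]_(j | P j) F j.
Proof. by move=> le_d PF; elim/big_rec: _ => // i x Pi; rewrite leq_min PF. Qed.

Lemma bigminn_attained P F i : P i -> (forall j, P j -> F j <= m) ->
  exists2 j, P j & \big[minn/m]_(j | P j) F j = F j.
Proof.
move=> Pi le_m; case: (arg_minnP F Pi) => j Pj min_j; exists j => //.
by apply/eqP; rewrite eqn_leq bigminn_le // bigminn_ge ?le_m.
Qed.
End BigMin.

Section Distance.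
Variable G : sgraph.
Implicit Types (x y z v w : G) (p : seq G).

Lemma dist_path_le x p : path (@adj G) x p -> dist x (last x p) <= size p.
Proof.
(* The minimum ranges over lengths below [#|G|]; for longer paths the bound holds because [dist]
   never exceeds its default value. *)
move=> path_p; have [lt_p|le_p] := ltnP (size p) #|G|; last first.
  apply: leq_trans le_p; rewrite /dist; elim/big_ind: _ => // [a b|i _].
    by rewrite geq_min => ->.
  exact: ltnW.
apply: (@bigminn_le _ _ _ (fun k : 'I_#|G| => k : nat) (Ordinal lt_p)).
by apply/existsP; exists (in_tuple p); rewrite path_p /=.
Qed.

Lemma dist_pathP x y : connect (@adj G) x y ->
  exists p, [/\ path (@adj G) x p, last x p = y & size p = dist x y].
Proof.
(* A path without repetition has fewer than [#|G|] edges, so the minimum is over a nonempty set and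
   is attained. *)
case/connectP=> p0 path0 ->; case: (shortenP path0) => p path_p uniq_p _.
have lt_p : size p < #|G| by have := max_card (mem (x :: p)); rewrite (card_uniqP uniq_p).
have walk_p : has_walk (Ordinal lt_p) x (last x p).
  by apply/existsP; exists (in_tuple p); rewrite path_p /=.
have [//|k /existsP[q /andP[path_q /eqP last_q]] Ek] :=
  bigminn_attained (m := #|G|) (P := fun k : 'I_#|G| => has_walk k x (last x p))
    (F := fun k : 'I_#|G| => k : nat) (i := Ordinal lt_p) walk_p.
  by move=> k _; apply: ltnW.
by exists q; rewrite size_tuple /dist Ek.
Qed.

Hypothesis conn : connected G.

Lemma dist_refl x : dist x x = 0.
Proof. by apply/eqP; rewrite -leqn0; apply: (@dist_path_le x [::]). Qed.

Lemma dist_eq0 x y : (dist x y == 0) = (x == y).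
Proof.
apply/eqP/eqP => [d0|->]; last exact: dist_refl.
have [p [_ last_p]] := dist_pathP (conn x y).
by rewrite d0; case: p last_p.
Qed.

Lemma dist_sym x y : dist x y = dist y x.
Proof.
suff le_d (a b : G) : dist a b <= dist b a by apply/eqP; rewrite eqn_leq !le_d.
have [p [path_p <- <-]] := dist_pathP (conn b a).
have:= @dist_path_le (last b p) (rev (belast b p)).
rewrite rev_path (eq_path (e' := @adj G)); last by move=> u v /=; apply: adj_sym.
move=> /(_ path_p); rewrite size_rev size_belast.
by case: p {path_p} => [//|c p]; rewrite /= rev_cons last_rcons.
Qed.

Lemma dist_triangle x y z : dist x z <= dist x y + dist y z.
Proof.
have [p [path_p last_p <-]] := dist_pathP (conn x y).
have [q [path_q last_q <-]] := dist_pathP (conn y z).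
rewrite -size_cat -last_q -last_p -last_cat.
by apply: dist_path_le; rewrite cat_path path_p last_p.
Qed.

Lemma dist_adj x y : adj x y -> dist x y = 1.
Proof.
move=> xy; apply/eqP; rewrite eqn_leq lt0n dist_eq0.
rewrite (contraL _ xy) ?andbT; last by move=> /eqP->; rewrite adj_irr.
by apply: (@dist_path_le x [:: y]); rewrite /= xy.
Qed.

(** Lower bounds on distances come from potentials that grow by at most one along each edge. *)
Lemma dist_lipschitz (f : G -> nat) x y :
  (forall u v, adj u v -> f v <= (f u).+1) -> f y <= f x + dist x y.
Proof.
move=> lip; have [p [path_p <- <-]] := dist_pathP (conn x y).
elim: p x path_p => [|z p IHp] x /=; first by rewrite addn0.
by case/andP=> xz /IHp/leq_trans; apply; rewrite addnS -addSn leq_add2r lip.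
Qed.

Lemma dist_next x y : x != y -> exists2 z, adj x z & dist x y = (dist z y).+1.
Proof.
have [[|z p] [/= path_p last_p size_p]] := dist_pathP (conn x y).
  by rewrite last_p eqxx.
case/andP: path_p => xz path_p _; exists z => //.
apply/eqP; rewrite eqn_leq; apply/andP; split.
  by rewrite -add1n -(dist_adj xz) dist_triangle.
by rewrite -size_p ltnS -last_p dist_path_le.
Qed.

Lemma dist_ecc x y : dist x y <= ecc y.
Proof. exact: (leq_bigmax (F := fun u : G => dist u y)). Qed.

Lemma eccP y : exists z, dist z y = ecc y.
Proof.
have G_gt0 : 0 < #|G| by apply/card_gt0P; exists y.
by have [z Ez] := eq_bigmax (fun u : G => dist u y) G_gt0; exists z.
Qed.

Lemma set_dist_le (X Y : {set G}) x y :
  x \in X -> y \in Y -> set_dist X Y <= dist x y.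
Proof.
move=> xX yY; apply: leq_trans (bigminn_le _ _ yY).
exact: (bigminn_le _ (fun u : G => \big[minn/#|G|]_(v in Y) dist u v) xX).
Qed.

Lemma dist_lt_card x y : dist x y < #|G|.
Proof.
case/connectP: (conn x y) => p0 path0 ->.
case: (shortenP path0) => p path_p uniq_p _.
apply: leq_ltn_trans (dist_path_le path_p) _.
by have := max_card (mem (x :: p)); rewrite (card_uniqP uniq_p).
Qed.

Lemma set_distP (X Y : {set G}) x y : x \in X -> y \in Y ->
  exists x' y', [/\ x' \in X, y' \in Y & set_dist X Y = dist x' y'].
Proof.
move=> xX yY.
have le_in u : \big[minn/#|G|]_(v in Y) dist u v <= #|G|.
  by apply: leq_trans (bigminn_le _ _ yY) _; rewrite ltnW ?dist_lt_card.
have [x' x'X Ex] := bigminn_attained (F := fun u =>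
  \big[minn/#|G|]_(v in Y) dist u v) xX (fun u _ => le_in u).
have [y' y'Y Ey] := bigminn_attained (F := fun v => dist x' v) yY
  (fun v _ => ltnW (dist_lt_card x' v)).
by exists x', y'; split; rewrite // /set_dist Ex Ey.
Qed.

Lemma center_nonempty x : exists c, c \in center G.
Proof.
case: (arg_minnP (@ecc G) (erefl (xpredT x))) => c _ min_c.
by exists c; rewrite inE; apply/forallP => u; apply: min_c.
Qed.

Lemma subtree_core_nonempty x : exists s, s \in subtree_core G.
Proof.
case: (arg_maxnP (@nb_subtrees G) (erefl (xpredT x))) => s _ max_s.
by exists s; rewrite inE; apply/forallP => u; apply: max_s.
Qed.

End Distance.

(** * Rooted subtrees and branches *)

Lemma connect_inv (T : finType) (e : rel T) (P : T -> Prop) x :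
  P x -> (forall a b, e a b -> P a -> P b) -> forall v, connect e x v -> P v.
Proof.
move=> Px Pe v /connectP[p path_p ->].
elim: p x Px path_p => //= y p IHp x Px /andP[/Pe Py]; apply: IHp; exact: Py.
Qed.

Section Counting.
Variable G : sgraph.
Implicit Types (x y z v w : G) (X Y S : {set G}).

Definition induced S : rel G := fun a b => [&& adj a b, a \in S & b \in S].

(** Stands for the subtrees inside X that contain x: in a tree these are determined by their
    vertices, so connected vertex sets are counted instead. *)
Definition rooted_sets X x :=
  [set S : {set G} | [&& S \subset X, x \in S &
                         [forall a in S, connect (induced S) x a]]].

Definition nrooted X x := #|rooted_sets X x|.

Lemma rooted_setsP X x S :
  reflect [/\ S \subset X, x \in S & forall a, a \in S -> connect (induced S) x a]
          (S \in rooted_sets X x).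
Proof.
rewrite inE; apply: (iffP and3P) => -[SX xS connS]; split=> //.
  by move=> a aS; apply: (implyP (forallP connS a)).
by apply/forallP => a; apply/implyP/connS.
Qed.

Lemma sub_connect_induced S S' a b :
  S \subset S' -> connect (induced S) a b -> connect (induced S') a b.
Proof.
move=> sub; apply: connect_sub => {}a {}b /and3P[ab aS bS]; apply: connect1.
by rewrite /induced ab !(subsetP sub).
Qed.

Lemma nrooted1 x : nrooted [set x] x = 1.
Proof.
suff -> : nrooted [set x] x = #|[set [set x]]| by rewrite cards1.
apply: eq_card => S; apply/rooted_setsP/set1P => [[sub xS _]|->].
  by apply/eqP; rewrite eqEsubset sub sub1set.
by rewrite subxx set11; split=> // a /set1P->; apply: connect0.
Qed.

Lemma nrooted_gt0 X x : x \in X -> 0 < nrooted X x.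
Proof.
move=> xX; apply/card_gt0P; exists [set x]; apply/rooted_setsP.
by rewrite sub1set set11; split=> // a /set1P->; apply: connect0.
Qed.

(** A connected set containing x consists of its part in X and of either nothing or a part in Y
    containing y, as Y is entered only along the edge xy. The successor counts the empty part. *)
Lemma nrooted_join X Y x y : x \in X -> y \in Y -> [disjoint X & Y] ->
  adj x y -> (forall a b, a \in X -> b \in Y -> adj a b -> a = x /\ b = y) ->
  nrooted (X :|: Y) x = nrooted X x * (nrooted Y y).+1.
Proof.
move=> xX yY disXY xy edge.
have disj a : a \in X -> a \notin Y by move=> aX; rewrite (disjointFr disXY).
pose D := setX (rooted_sets X x) (set0 |: rooted_sets Y y).
have DP AB : AB \in D -> AB.1 \in rooted_sets X x /\
    (AB.2 = set0 \/ AB.2 \in rooted_sets Y y).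
  by rewrite inE => /andP[-> /setU1P].
have subD AB : AB \in D -> AB.1 \subset X /\ AB.2 \subset Y.
  case/DP => /rooted_setsP[-> _ _] [->|/rooted_setsP[-> _ _]] //.
  by rewrite sub0set.
have inj : {in D &, injective (fun AB => AB.1 :|: AB.2)}.
  move=> [A B] [A' B'] /subD/=[AX BY] /subD/=[AX' BY'] /setP E.
  have out (C Z : {set G}) c : C \subset Z -> c \notin Z -> (c \in C) = false.
    by move=> CZ; apply: contraNF => /(subsetP CZ).
  have AE a : (a \in A) = (a \in A').
    have := E a; rewrite !inE.
    have [aX|aNX] := boolP (a \in X).
      by rewrite (out _ _ _ BY (disj a aX)) (out _ _ _ BY' (disj a aX)) !orbF.
    by rewrite (out _ _ _ AX aNX) (out _ _ _ AX' aNX).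
  have BE a : (a \in B) = (a \in B').
    have := E a; rewrite !inE.
    have [aX|aNX] := boolP (a \in X).
      by rewrite (out _ _ _ BY (disj a aX)) (out _ _ _ BY' (disj a aX)).
    by rewrite (out _ _ _ AX aNX) (out _ _ _ AX' aNX).
  by congr pair; apply/setP.
have -> : nrooted X x * (nrooted Y y).+1 = #|D|.
  have s0 : set0 \notin rooted_sets Y y.
    by apply/negP => /rooted_setsP[_]; rewrite inE.
  by rewrite cardsX cardsU1 s0 add1n.
rewrite -(card_in_imset inj); apply: eq_card => S.
apply/rooted_setsP/imsetP => [[SXY xS connS]|[[A B] AB_D ->]]; last first.
  have [/rooted_setsP/=[AX xA connA] HB] := DP _ AB_D.
  have [_ /= BY] := subD _ AB_D.
  split; [exact: setUSS | by rewrite inE xA | move=> a /setUP[aA|aB]].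
    by apply: sub_connect_induced (connA a aA); apply: subsetUl.
  case: HB => [/= B0|/rooted_setsP/=[_ yB connB]]; first by rewrite B0 inE in aB.
  apply: (@connect_trans _ _ y).
    by apply: connect1; rewrite /induced xy !inE xA yB orbT.
  by apply: sub_connect_induced (connB a aB); apply: subsetUr.
(* Invariant along a walk in S from x; a return from Y to X can only land at x, and an entry into Y
   only at y. *)
have key a : connect (induced S) x a ->
    (a \in X -> connect (induced (S :&: X)) x a) /\
    (a \in Y -> y \in S /\ connect (induced (S :&: Y)) y a).
  move: a; apply: connect_inv.
    by split=> [_|xY]; [apply: connect0 | have := disj x xX; rewrite xY].
  move=> a b /and3P[ab aS bS] [aXP aYP]; split=> [bX|bY].
    have /setUP[aX|aY] := subsetP SXY a aS.
      apply: connect_trans (aXP aX) (connect1 _).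
      by rewrite /induced ab !inE aS bS aX.
    by rewrite adj_sym in ab; have [-> _] := edge _ _ bX aY ab; apply: connect0.
  have /setUP[aX|aY] := subsetP SXY a aS.
    have [_ <-] := edge _ _ aX bY ab; split=> //; exact: connect0.
  have [yS conn_a] := aYP aY; split=> //.
  apply: connect_trans conn_a (connect1 _).
  by rewrite /induced ab !inE aS bS aY.
exists (S :&: X, S :&: Y); last by rewrite /= -setIUr; apply/esym/setIidPl.
rewrite inE /=; apply/andP; split.
  apply/rooted_setsP; rewrite subsetIr inE xS xX; split=> // a /setIP[aS aX].
  by have [/(_ aX)] := key a (connS a aS).
apply/setU1P; have [->|[b /setIP[bS bY]]] := set_0Vmem (S :&: Y); [by left|right].
have [_ /(_ bY)[yS _]] := key b (connS b bS).
apply/rooted_setsP; rewrite subsetIr inE yS yY; split=> // a /setIP[aS aY].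
by have [_ /(_ aY)[]] := key a (connS a aS).
Qed.

End Counting.

(** * The two branches at an edge of a tree *)

Section Branch.
Variable G : sgraph.
Implicit Types (p q x y z u v w : G) (X Y S : {set G}).

Definition cut x y : rel G := fun a b =>
  adj a b && ~~ ((a == x) && (b == y) || (a == y) && (b == x)).

(** For adjacent x and y, the component of y after deletion of the edge xy; the root is the second
    argument. *)
Definition branch x y := [set v | connect (cut x y) y v].

Definition fcount x y := nrooted (branch x y) y.

Lemma cut_sym x y : symmetric (cut x y).
Proof. by move=> a b; rewrite /cut adj_sym orbC ![(b == _) && _]andbC. Qed.

Lemma cutC x y : cut x y =2 cut y x.
Proof. by move=> a b; rewrite /cut orbC. Qed.

Lemma branch_root x y : y \in branch x y.
Proof. by rewrite inE connect0. Qed.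

Lemma branch_step x y a b :
  a \in branch x y -> cut x y a b -> b \in branch x y.
Proof. by rewrite !inE => conn_a /connect1; apply: connect_trans. Qed.

Hypothesis treeG : tree G.
Let conn : connected G := treeG.1.

(** A simple path from y to x avoiding the edge xy would close up with it to a cycle of length at
    least 3. *)
Lemma branch_parent x y : adj x y -> x \notin branch x y.
Proof.
move=> xy; rewrite inE; apply/negP => /connectP[p0 path0 last0].
case: (shortenP path0) last0 => p path_p uniq_p _ last_p.
have path_adj : path (@adj G) y p by apply: sub_path path_p => a b /andP[].
have := treeG.2 (y :: p); rewrite /ucycle uniq_p andbT /= rcons_path path_adj.
rewrite -last_p xy => /(_ isT); case: p last_p path_p {path_adj uniq_p} => [|z []] //=.
  by move=> xy'; rewrite xy' adj_irr in xy.
by move=> ->; rewrite /cut !eqxx orbT andbF.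
Qed.

Lemma branchC x y v : adj x y -> (v \in branch y x) = (v \notin branch x y).
Proof.
move=> xy; apply/idP/idP => [v_x|].
  apply/negP => v_y; have := branch_parent xy; rewrite inE => /negP; apply.
  rewrite !inE (eq_connect (cutC y x)) in v_x v_y.
  by rewrite (connect_trans v_y) // (sym_connect_sym (@cut_sym x y)).
move: v (conn x v); apply: connect_inv => [|a b ab IHa b_y]; first by rewrite branch_root.
have [cab|] := boolP (cut x y a b).
  rewrite (branch_step (a := a)) 1?cutC ?IHa //; apply: contra b_y => a_y.
  exact: branch_step cab.
rewrite /cut ab negbK => /orP[/andP[_ /eqP b_eq]|/andP[_ /eqP->]].
  by rewrite b_eq branch_root in b_y.
exact: branch_root.
Qed.

Lemma branch_edge x y a b : adj x y -> a \in branch x y -> b \in branch y x ->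
  adj a b -> a = y /\ b = x.
Proof.
move=> xy a_y b_x ab; have [cab|] := boolP (cut x y a b).
  by move: b_x; rewrite branchC // (branch_step a_y cab).
rewrite /cut ab negbK => /orP[/andP[/eqP a_eq _]|/andP[/eqP-> /eqP->]] //.
by rewrite a_eq (negPf (branch_parent xy)) in a_y.
Qed.

Lemma dist_branch x y a b : adj x y -> a \in branch y x -> b \in branch x y ->
  dist a b = dist a x + (dist y b).+1.
Proof.
move=> xy a_x b_y; apply/eqP; rewrite eqn_leq; apply/andP; split.
  apply: leq_trans (dist_triangle conn a x b) _; rewrite leq_add2l.
  by rewrite -add1n -(dist_adj conn xy) dist_triangle.
(* A potential with the claimed value at b; it is Lipschitz because xy is the only edge between the
   two branches. *)
pose f v := if v \in branch x y then dist a x + (dist y v).+1 else dist a v.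
have := @dist_lipschitz _ conn f a b; rewrite /f b_y -(negbK (a \in _)).
rewrite -branchC // a_x /= dist_refl //; apply => u v uv.
have tri c : dist c v <= (dist c u).+1.
  by rewrite -addn1 -(dist_adj conn uv) dist_triangle.
have [v_y|v_x] := ifPn; have [u_y|u_x] := ifPn.
- by rewrite -addnS leq_add2l ltnS.
- rewrite -branchC // in u_x; rewrite adj_sym in uv.
  have [-> ->] := branch_edge xy v_y u_x uv.
  by rewrite dist_refl // addn1.
- rewrite -branchC // in v_x; have [-> ->] := branch_edge xy u_y v_x uv.
  by lia.
- exact: tri.
Qed.

Lemma dist_branchl x y v : adj x y -> v \in branch x y ->
  dist x v = (dist y v).+1.
Proof.
by move=> xy v_y; rewrite (dist_branch xy (branch_root y x) v_y) dist_refl.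
Qed.

(** A walk from y inside its branch never returns to x, hence never uses the edge xz. *)
Lemma branch_sub x y z : adj x y -> adj x z -> y != z ->
  branch x y \subset branch z x.
Proof.
move=> xy xz yNz; apply/subsetP => v v_y.
suff [] : v \in branch x y /\ v \in branch z x by [].
rewrite inE in v_y; move: v v_y; apply: connect_inv => [|a b cab [a_y a_x]].
  rewrite branch_root; split=> //; apply: branch_step (branch_root z x) _.
  have yNx : y != x by apply: contraTneq xy => ->; rewrite adj_irr.
  by rewrite /cut xy (negPf yNz) (negPf yNx) !andbF.
have b_y := branch_step a_y cab; split=> //.
have aNx : a != x by apply: contraNneq (branch_parent xy) => {1}<-.
have bNx : b != x by apply: contraNneq (branch_parent xy) => {1}<-.
by apply: branch_step a_x _; case/andP: cab => ab _; rewrite /cut ab (negPf aNx)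
  (negPf bNx) andbF.
Qed.

Lemma branch_next x v : x != v -> exists2 y, adj x y & v \in branch x y.
Proof.
case/(dist_next conn) => y xy Exv; exists y => //; apply: contraT => v_x.
rewrite -branchC // in v_x; rewrite adj_sym in xy.
by have := dist_branchl xy v_x; rewrite Exv; lia.
Qed.

Lemma branch_disj x y z v : adj x y -> adj x z -> v \in branch x y ->
  v \in branch x z -> y = z.
Proof.
move=> xy xz v_y v_z; apply/eqP; apply: contraTT v_z => yNz.
by rewrite -branchC // (subsetP (branch_sub xy xz yNz)).
Qed.

Lemma branch_child p x v : adj p x -> v \in branch p x -> v != x ->
  exists y, [/\ adj x y, y != p & v \in branch x y].
Proof.
move=> px v_x vNx; have [|y xy v_y] := @branch_next x v; first by rewrite eq_sym.
exists y; split=> //; apply: contraTneq v_x => y_eq.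
by rewrite y_eq in xy v_y; rewrite branchC // negbK.
Qed.

Lemma branch_childS p x y : adj p x -> adj x y -> y != p ->
  branch x y \subset branch p x.
Proof. by move=> px xy yNp; apply: branch_sub; rewrite // adj_sym. Qed.

(** Adding x to each subtree counted at y, together with x alone, already gives one more. *)
Lemma fcount_child p x y : adj p x -> adj x y -> y != p ->
  fcount x y < fcount p x.
Proof.
move=> px xy yNp; have sub := branch_childS px xy yNp.
have xX : x \in branch p x :\: branch x y by rewrite inE branch_root branch_parent.
rewrite /fcount -(setID (branch p x) (branch x y)) setUC (setIidPr sub).
rewrite (@nrooted_join _ _ _ x y) ?branch_root //.
- by rewrite leq_pmull ?nrooted_gt0.
- by rewrite -setI_eq0 setDE -setIA [~: _ :&: _]setIC setICr setI0.
- move=> a b; rewrite inE -branchC // => /andP[a_x _] b_y ab.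
  by rewrite adj_sym in ab; have [-> ->] := branch_edge xy b_y a_x ab.
Qed.

Lemma branch_cover x y : adj x y -> branch y x :|: branch x y = setT.
Proof. by move=> xy; apply/setP => v; rewrite in_setU in_setT branchC // orNb. Qed.

Lemma card_branchC x y : adj x y -> #|branch y x| + #|branch x y| = #|G|.
Proof.
move=> xy; rewrite -cardsUI branch_cover // cardsT (_ : _ :&: _ = set0) ?cards0 ?addn0 //.
by apply/setP => v; rewrite in_setI in_set0 branchC // andNb.
Qed.

(* By acyclicity a subtree is determined by its vertex set. *)
Lemma nb_subtrees_nrooted x : nb_subtrees x = nrooted setT x.
Proof.
pose edges (S : {set G}) := [set ab : G * G | induced S ab.1 ab.2].
have edgesE H : is_subtree H -> H.2 = edges H.1.
  case: H => S E /and3P[/= /forallP subE _ /forallP connE].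
  have {}subE a b : (a, b) \in E -> [&& adj a b, a \in S, b \in S & (b, a) \in E].
    by move: (subE a) => /forallP/(_ b)/implyP.
  apply/setP => -[a b]; rewrite inE /=; apply/idP/and3P => [/subE/and4P[]//|[ab aS bS]].
  have := connE a; rewrite aS => /forallP/(_ b); rewrite bS => /connectP[p0 path0 last0].
  (* The edges of the subtree join a to b by a simple path; unless it is the edge ab itself, it
     would close up with ab to a cycle. *)
  case: (shortenP path0) last0 => p path_p uniq_p _ last_p.
  have path_adj : path (@adj G) a p by apply: sub_path path_p => c d /subE/andP[].
  have := treeG.2 (a :: p); rewrite /ucycle uniq_p andbT /= rcons_path path_adj.
  rewrite -last_p adj_sym ab => /(_ isT).
  case: p last_p path_p {path_adj uniq_p} => [|z []] //=.
    by move=> ba; rewrite ba adj_irr in ab.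
  by move=> ->; rewrite andbT.
rewrite /nb_subtrees -(@card_in_imset _ _ (fun H : {set G} * {set G * G} => H.1)).
  apply: eq_card => S; apply/imsetP/rooted_setsP => [[[S' E]]|[_ xS connS]].
    rewrite inE => /andP[treeH /= xS'] ->; have /= EE := edgesE _ treeH.
    split; rewrite ?subsetT // => a aS'.
    case/and3P: treeH => _ _ /forallP/(_ x); rewrite /= xS' => /forallP/(_ a).
    rewrite aS' EE; apply: (connect_sub _) => c d; rewrite inE; exact: connect1.
  exists (S, edges S) => //; rewrite inE /= xS andbT; apply/and3P; split.
  - apply/forallP => a; apply/forallP => b; apply/implyP; rewrite !inE /induced /=.
    by rewrite [adj b a]adj_sym => /and3P[-> -> ->].
  - by apply/set0Pn; exists x.
  apply/forallP => a; apply/implyP => aS; apply/forallP => b; apply/implyP => bS.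
  have E : (fun c d => (c, d) \in edges S) =2 induced S by move=> c d; rewrite inE.
  rewrite /= (eq_connect E); apply: (@connect_trans _ _ x); last exact: connS.
  rewrite (sym_connect_sym _) ?connS // => c d.
  by rewrite /induced adj_sym [(c \in S) && _]andbC.
move=> H H'; rewrite !inE => /andP[tH _] /andP[tH' _] E.
by rewrite [H]surjective_pairing [H']surjective_pairing (edgesE _ tH)
  (edgesE _ tH') E.
Qed.

Lemma nb_subtrees_edge x y : adj x y ->
  nb_subtrees x = fcount y x * (fcount x y).+1.
Proof.
move=> xy; rewrite nb_subtrees_nrooted -(branch_cover xy).
apply: nrooted_join; rewrite ?branch_root //.
  by rewrite -setI_eq0; apply/eqP/setP => v; rewrite in_setI in_set0 branchC // andNb.
move=> a b a_x b_y; rewrite adj_sym => ab.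
by have [-> ->] := branch_edge xy b_y a_x ab.
Qed.

(** Both counts contain the subtrees through the edge xy, as many as the product of the branch
    counts; the rest are the subtrees in one branch. *)
Lemma leq_nb_subtrees x y : adj x y ->
  (nb_subtrees x <= nb_subtrees y) = (fcount y x <= fcount x y).
Proof.
move=> xy; rewrite (nb_subtrees_edge xy); rewrite adj_sym in xy.
by rewrite (nb_subtrees_edge xy) !mulnS mulnC leq_add2r.
Qed.

(** Each step of s away from u shrinks the branch rooted at s and enlarges the complementary one. *)
Lemma fcount_chain u w s : adj u w -> s \in branch u w ->
  exists p, [/\ adj s p, u \in branch s p, fcount p s <= fcount u w
              & fcount w u <= fcount s p].
Proof.
move=> uw; have [n le_n] := ubnP (dist s u).
elim: n s le_n => // n IHn s le_n s_w.
have sNu : s != u by apply: contraNneq (branch_parent uw) => {1}<-.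
have [p sp u_p] := branch_next sNu.
have [p_w|p_u] := boolP (p \in branch u w); last first.
  rewrite -branchC // in p_u; have [s_eq p_eq] := branch_edge uw s_w p_u sp.
  by exists u; rewrite s_eq p_eq in sp u_p *; rewrite branch_root.
have ps : adj p s by rewrite adj_sym.
have [|q [pq u_q le1 le2]] := IHn p _ p_w.
  by have := dist_branchl sp u_p; lia.
have qNs : q != s by apply: contraTneq u_q => ->; rewrite -branchC // adj_sym.
exists p; split=> //.
  by apply: leq_trans le1; apply/ltnW/fcount_child; rewrite 1?adj_sym // eq_sym.
by apply: leq_trans le2 _; apply/ltnW/fcount_child.
Qed.

(** Otherwise the neighbour of s towards u would lie in strictly more subtrees. *)
Lemma subtree_core_branch u w s : adj u w -> fcount u w < fcount w u ->
  s \in subtree_core G -> s \notin branch u w.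
Proof.
move=> uw lt_f; rewrite inE => /forallP max_s; apply/negP => s_w.
have [p [sp _ le1 le2]] := fcount_chain uw s_w.
have := max_s p; rewrite leq_nb_subtrees 1?adj_sym // leqNgt.
by rewrite (leq_ltn_trans le1 (leq_trans lt_f le2)).
Qed.

End Branch.

(** * Branches of binary trees *)

Lemma opt_balanced u v : balanced u v -> opt (u + v).+1 = (opt u * opt v).+1.
Proof.
move=> Buv; apply/eqP; rewrite eqn_leq opt_mul andbT optS ltnS.
by apply/bigmax_leqP => -[i lt_i] _ /=; apply: balanced_opt; rewrite // subnKC.
Qed.

Section Binary.
Variable G : sgraph.
Implicit Types (p q x y z u v w : G) (X Y S : {set G}).

Lemma pendant_adj x y z : pendant x -> adj x y -> adj x z -> y = z.
Proof.
rewrite /pendant /degree => /cards1P[a /setP Ea] xy xz.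
have := Ea y; have := Ea z; rewrite !inE xy xz.
by move=> /esym/eqP-> /esym/eqP->.
Qed.

Lemma pendant_exists x : pendant x -> exists y, adj x y.
Proof.
rewrite /pendant /degree => /cards1P[a /setP/(_ a)]; rewrite !inE eqxx.
by exists a.
Qed.

Lemma degree2P x : degree x = 2 -> exists y z,
  [/\ y != z, adj x y, adj x z & forall w, adj x w -> w = y \/ w = z].
Proof.
move=> /eqP/cards2P[y [z [yNz /setP E]]]; exists y, z; split=> //.
- by have := E y; rewrite !inE eqxx.
- by have := E z; rewrite !inE eqxx orbT.
by move=> w xw; have := E w; rewrite !inE xw => /esym/orP[]/eqP->; [left|right].
Qed.

Lemma degree3P x p : degree x = 3 -> adj x p -> exists y z,
  [/\ y != z, y != p /\ z != p, adj x y, adj x z &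
      forall w, adj x w -> [\/ w = p, w = y | w = z]].
Proof.
rewrite /degree (cardsD1 p) inE => + xp; rewrite xp => -[] /eqP/cards2P[y [z [yNz /setP E]]].
have := E y; have := E z; rewrite !inE !eqxx orbT => /andP[zNp xz] /andP[yNp xy].
exists y, z; split=> // w xw; have := E w; rewrite !inE xw andbT.
have [->|_ /esym/orP[]/eqP->] := eqVneq w p; by [constructor 1|constructor 2|constructor 3].
Qed.

Hypothesis treeG : tree G.
Let conn : connected G := treeG.1.

Lemma branch_pendant p x : adj p x -> pendant x -> branch p x = [set x].
Proof.
move=> px pend_x; apply/setP => v; rewrite in_set1.
have [->|vNx] := eqVneq v x; first by rewrite branch_root.
apply/negP => v_x; have [y [xy /eqP[]]] := branch_child treeG px v_x vNx.
by apply: pendant_adj pend_x xy _; rewrite adj_sym.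
Qed.

(** Describes both a branch whose root has degree 3 and a whole tree seen from a vertex of degree 2,
    so both are counted at once. *)
Definition fork x y z := x |: (branch x y :|: branch x z).

Lemma fork_branch p x y z : adj x p -> adj x y -> adj x z -> y != p -> z != p ->
  (forall w, adj x w -> [\/ w = p, w = y | w = z]) -> branch p x = fork x y z.
Proof.
move=> xp xy xz yNp zNp nbr; have px : adj p x by rewrite adj_sym.
apply/eqP; rewrite eqEsubset subUset sub1set branch_root subUset.
rewrite !branch_childS // !andbT; apply/subsetP => v v_x.
have [->|vNx] := eqVneq v x; first exact: setU11.
have [w [xw wNp v_w]] := branch_child treeG px v_x vNx.
rewrite /fork in_setU1 in_setU.
have [w_eq|<-|<-] := nbr w xw; last 2 first; rewrite ?v_w ?orbT //.
by rewrite w_eq eqxx in wNp.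
Qed.

Lemma fork_setT x y z : adj x y -> adj x z ->
  (forall w, adj x w -> w = y \/ w = z) -> setT = fork x y z.
Proof.
move=> xy xz nbr; apply/esym/eqP; rewrite -subTset; apply/subsetP => v _.
have [->|vNx] := eqVneq v x; first exact: setU11.
have [|w xw v_w] := @branch_next _ treeG x v; first by rewrite eq_sym.
by rewrite /fork in_setU1 in_setU; have [<-|<-] := nbr w xw; rewrite v_w !orbT.
Qed.

Section Fork.
Variables x y z : G.
Hypotheses (xy : adj x y) (xz : adj x z) (yNz : y != z).

Lemma branch_disjoint : [disjoint branch x y & branch x z].
Proof.
rewrite -setI_eq0; apply/eqP/setP => v; rewrite in_setI in_set0.
by apply/negP => /andP[v_y /(branch_disj treeG xy xz v_y)/eqP]; apply/negP.
Qed.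

Lemma card_fork : #|fork x y z| = (#|branch x y| + #|branch x z|).+1.
Proof.
rewrite cardsU1 in_setU !(negPf (branch_parent _ _)) // add1n; congr _.+1.
rewrite cardsU (_ : _ :&: _ = set0) ?cards0 ?subn0 //.
by apply/eqP; rewrite setI_eq0 branch_disjoint.
Qed.

Lemma nrooted_fork :
  nrooted (fork x y z) x = (fcount x y).+1 * (fcount x z).+1.
Proof.
have edge u a b : adj x u -> b \in branch x u -> a \notin branch x u ->
    adj a b -> a = x /\ b = u.
  move=> xu b_u a_u ab; rewrite adj_sym in ab; rewrite -branchC // in a_u.
  by have [-> ->] := branch_edge treeG xu b_u a_u ab.
rewrite /fork setUA (@nrooted_join _ _ _ x z) ?branch_root ?setU11 //.
- rewrite (@nrooted_join _ _ _ x y) ?branch_root ?set11 //.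
  + by rewrite nrooted1 mul1n.
  + by rewrite disjoints1 branch_parent.
  + move=> a b /set1P-> b_y xb; apply: edge b_y _ xb => //.
    exact: branch_parent.
- rewrite disjoints_subset subUset sub1set in_setC branch_parent //.
  by rewrite -disjoints_subset branch_disjoint.
- move=> a b a_xy b_z; apply: edge => //; case/setU1P: a_xy => [->|a_y].
    exact: branch_parent.
  by rewrite (disjointFr branch_disjoint a_y).
Qed.

Lemma dist_fork v : v \in fork x y z -> v != x ->
  v \in branch x y /\ dist x v = (dist y v).+1 \/
  v \in branch x z /\ dist x v = (dist z v).+1.
Proof.
case/setU1P => [->|/setUP[v_y|v_z] _]; first by rewrite eqxx.
  by left; rewrite (dist_branchl treeG xy v_y).
by right; rewrite (dist_branchl treeG xz v_z).
Qed.

End Fork.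

(** Turns branches into terms, so that the numerical bounds proved by structural induction apply to
    them. *)
Lemma branch_btree p x : adj p x ->
  (forall v, v \in branch p x -> ~~ pendant v -> degree v = 3) ->
  exists t, [/\ #|branch p x| = (internal t).*2.+1, fcount p x = bcount t,
    exists2 v, v \in branch p x & dist x v = bheight t &
    forall v, v \in branch p x -> dist x v <= bheight t].
Proof.
have [n le_n] := ubnP #|branch p x|.
elim: n p x le_n => // n IHn p x le_n px deg.
have [pend_x|npend_x] := boolP (pendant x).
  exists Leaf; rewrite /fcount (branch_pendant px pend_x) cards1 nrooted1.
  split=> //= [|v /set1P->]; last by rewrite dist_refl.
  by exists x; rewrite ?set11 ?dist_refl.
have xp : adj x p by rewrite adj_sym.
have [||y [z [yNz [yNp zNp] xy xz nbr]]] := @degree3P x p => //.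
  by apply: deg; rewrite ?branch_root.
have Ebr := fork_branch xp xy xz yNp zNp nbr; rewrite Ebr in le_n.
have card_f := card_fork xy xz yNz; rewrite card_f in le_n.
have [|//|v v_y|ty [cy fy [vy vy_y dy] max_y]] := IHn x y; first by lia.
  by apply: deg; apply: subsetP v v_y; apply: branch_childS.
have [|//|v v_z|tz [cz fz [vz vz_z dz] max_z]] := IHn x z; first by lia.
  by apply: deg; apply: subsetP v v_z; apply: branch_childS.
exists (Node ty tz); rewrite /fcount Ebr card_f nrooted_fork // fy fz /=.
split=> //.
- by rewrite cy cz; lia.
- have [le_yz|/ltnW le_zy] := leqP (bheight ty) (bheight tz).
    exists vz; first by rewrite !in_setU vz_z !orbT.
    by rewrite (dist_branchl treeG xz vz_z) dz.
  exists vy; first by rewrite !in_setU vy_y !orbT.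
  by rewrite (dist_branchl treeG xy vy_y) dy.
- move=> v v_f; have [->|vNx] := eqVneq v x; first by rewrite dist_refl.
  have [[v_y ->]|[v_z ->]] := dist_fork xy xz v_f vNx; rewrite ltnS leq_max.
    by rewrite max_y.
  by rewrite max_z ?orbT.
Qed.

End Binary.

(** * Rgood trees *)

Section Rgood.
Variables (R : sgraph) (r : R).
Hypotheses (treeR : tree R) (degree_root : degree r = 2).
Hypothesis degree_nonroot : forall v, v != r -> degree v = 1 \/ degree v = 3.
Hypothesis pendant_height :
  forall u v : R, pendant u -> pendant v -> height r u <= (height r v).+1.
Variable le : rel R.
Hypothesis le_ordering : is_ordering r le.
Hypothesis le_deepest : {in level r (max_height r).-1 &, forall x y,
  x \in parents_of_deepest r -> le x y -> y \in parents_of_deepest r}.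
Implicit Types (p q x y z u v w : R).
Let conn : connected R := treeR.1.
Let H := max_height r.

Lemma height_le v : height r v <= H.
Proof. exact: (leq_bigmax (F := height r)). Qed.

Lemma height_root : height r r = 0. Proof. exact: dist_refl. Qed.

Lemma height_neq_root v : 0 < height r v -> v != r.
Proof. by apply: contraTneq => ->; rewrite height_root. Qed.

Lemma parent_exists v : v != r ->
  exists p, [/\ adj p v, r \in branch v p & height r v = (height r p).+1].
Proof.
move=> vNr; have [p vp r_p] := branch_next treeR vNr.
exists p; rewrite adj_sym; split=> //.
by rewrite /height dist_sym // (dist_branchl treeR vp r_p) dist_sym.
Qed.

(** For adjacent p and v, [r \in branch v p] expresses that p is the parent of v. *)
Lemma child_branch p v y : adj p v -> r \in branch v p -> adj v y -> y != p ->
  r \in branch y v.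
Proof.
move=> pv r_p vy yNp; apply: subsetP r_p; rewrite adj_sym in pv.
by apply: branch_sub; rewrite // eq_sym.
Qed.

Lemma height_branch p x v : adj p x -> r \in branch x p -> v \in branch p x ->
  height r v = height r x + dist x v.
Proof.
move=> px r_p v_x; rewrite /height (dist_branch treeR px r_p v_x).
by rewrite (dist_branch treeR px r_p (branch_root p x)) dist_refl // addn1 addSnnS.
Qed.

Lemma height_child p x : adj p x -> r \in branch x p ->
  height r x = (height r p).+1.
Proof.
move=> px r_p.
by rewrite /height (dist_branch treeR px r_p (branch_root p x)) dist_refl // addn1.
Qed.

Lemma nonpendant_nbrs p x : adj p x -> r \in branch x p -> ~~ pendant x ->
  exists y z, [/\ y != z, y != p /\ z != p, adj x y, adj x z &
      forall w, adj x w -> [\/ w = p, w = y | w = z]].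
Proof.
move=> px r_p npend; rewrite adj_sym in px; apply: degree3P => //.
have [|deg1|//] := degree_nonroot (v := x).
  by apply: contraTneq r_p => <-; apply: branch_parent.
by rewrite /pendant deg1 in npend.
Qed.

Lemma deepest_pendant v : v != r -> height r v = H -> pendant v.
Proof.
move=> vNr hv; have [p [pv r_p _]] := parent_exists vNr.
apply: contraT => /(nonpendant_nbrs pv r_p)[y [z [_ [yNp _] vy _ _]]].
have := height_child vy (child_branch pv r_p vy yNp); rewrite hv => hy.
by have := height_le y; rewrite hy ltnn.
Qed.

Lemma max_height_gt0 : 0 < H.
Proof.
have [y [z [_ ry _ _]]] := degree2P degree_root.
by apply: leq_trans (height_le y); rewrite /height dist_adj.
Qed.

Lemma deepest_exists : exists2 v, v != r & height r v = H.
Proof.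
have R_gt0 : 0 < #|R| by apply/card_gt0P; exists r.
have [v Ev] := eq_bigmax (fun v : R => height r v) R_gt0.
by exists v; rewrite // height_neq_root // -Ev max_height_gt0.
Qed.

Lemma shallow_nonpendant v : height r v < H.-1 -> ~~ pendant v.
Proof.
have [u uNr hu] := deepest_exists; move=> lt_v; apply: contraTN lt_v => pend_v.
have := pendant_height (deepest_pendant uNr hu) pend_v; rewrite hu; lia.
Qed.

Lemma pred_in_branch x y v : adj x y -> r \in branch y x -> v \in branch x y ->
  v != y ->
  exists q, [/\ q \in branch x y, is_parent r q v, height r v = (height r q).+1
              & dist y v = (dist y q).+1].
Proof.
move=> xy r_x v_y vNy; have [q vq Ed] := dist_next conn vNy.
have q_y : q \in branch x y.
  apply: contraT; rewrite -branchC // => q_x.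
  by have [v_eq _] := branch_edge treeR xy v_y q_x vq; rewrite v_eq eqxx in vNy.
have {}Ed : dist y v = (dist y q).+1 by rewrite dist_sym // Ed dist_sym.
have hv : height r v = (height r q).+1.
  by rewrite (height_branch xy r_x v_y) (height_branch xy r_x q_y) Ed addnS.
by exists q; rewrite /is_parent adj_sym vq hv eqxx.
Qed.

Lemma deepest_parent x y v : adj x y -> r \in branch y x -> height r y < H ->
  v \in branch x y -> height r v = H ->
  exists2 q, q \in branch x y & (q \in parents_of_deepest r) /\ height r q = H.-1.
Proof.
move=> xy r_x lt_y v_y hv.
have vNy : v != y by apply: contraTneq lt_y => <-; rewrite hv ltnn.
have [q [q_y qv hq _]] := pred_in_branch xy r_x v_y vNy.
exists q => //; split; last by rewrite -hv hq.
have vNr : v != r by rewrite height_neq_root // hv max_height_gt0.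
by rewrite inE; apply/existsP; exists v; rewrite deepest_pendant // hv eqxx.
Qed.

Lemma deepest_parent_nonpendant u : u != r -> u \in parents_of_deepest r ->
  ~~ pendant u.
Proof.
move=> uNr; rewrite inE => /existsP[v /and3P[_ _ /andP[uv /eqP hv]]].
have [p [pu _ hu]] := parent_exists uNr.
apply/negP => pend_u; rewrite adj_sym in pu.
have Epv := pendant_adj pend_u pu uv; move: hv; rewrite -Epv hu; lia.
Qed.

(** Descendants inherit the order of two siblings level by level, since the parents of q and w lie
    in disjoint branches and so are distinct. *)
Lemma ordering_branch x y z q w : adj x y -> adj x z -> y != z ->
  r \in branch y x -> r \in branch z x -> le y z ->
  q \in branch x y -> w \in branch x z -> height r q = height r w -> le q w.
Proof.
move=> xy xz yNz r_y r_z le_yz.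
have hyz : height r y = height r z by rewrite (height_child xy r_y) (height_child xz r_z).
have [i Ei] : exists i, dist y q = i by exists (dist y q).
elim: i q w Ei => [|i IHi] q w Eq q_y w_z.
  move/eqP: Eq; rewrite dist_eq0 // => /eqP<-.
  rewrite (height_branch xz r_z w_z) hyz => /esym/eqP.
  by rewrite -{2}[height r z]addn0 eqn_add2l dist_eq0 // => /eqP<-.
move=> hqw; have Ew : dist z w = i.+1.
  move: hqw; rewrite (height_branch xz r_z w_z) (height_branch xy r_y q_y) Eq.
  by rewrite hyz => /addnI.
have [|q' [q'_y pq hq dq]] := pred_in_branch xy r_y q_y.
  by rewrite eq_sym -(dist_eq0 conn) Eq.
have [|w' [w'_z pw hw dw]] := pred_in_branch xz r_z w_z.
  by rewrite eq_sym -(dist_eq0 conn) Ew.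
have le_qw' : le q' w'.
  apply: IHi => //; [by move: dq; rewrite Eq => -[] | by move: hqw; rewrite hq hw => -[]].
have h_gt0 : 0 < height r q'.
  by rewrite (height_branch xy r_y q'_y) (height_child xy r_y) addSn.
have [_ _ _ /(_ q w)] := le_ordering h_gt0.
rewrite !inE -hqw hq eqxx => /(_ isT isT q' w' pq pw) ->//.
apply: contraTneq w'_z => <-.
by apply/negP => q'_z; move/eqP: yNz; apply; apply: branch_disj q'_y q'_z.
Qed.

(* The leaves below x are at distance g or g + 1 from x. *)
Definition shape g (B : {set R}) x k :=
  [/\ #|B| = k.*2.+1, (nrooted B x).+1 = opt k, 2 ^ g <= k.+1 <= 2 ^ g.+1,
      ((exists2 v, v \in B & height r v = H) -> 2 ^ g < k.+1) /\
      ((forall v, v \in B -> height r v <> H) -> k.+1 = 2 ^ g) &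
      (forall v, v \in B -> height r v = H.-1 -> ~~ pendant v) ->
      k.+1 = 2 ^ g.+1].

(** The last conditions of [shape] record the extreme cases: a branch without vertices at level H is
    complete of depth g, one without leaves at level H - 1 is complete of depth g + 1. Of two
    siblings at least one is extreme, so their pair is balanced. *)
Lemma shape_fork g x y z : adj x y -> adj x z -> y != z ->
  r \in branch y x -> r \in branch z x -> height r x + g.+1 = H ->
  (0 < g -> exists ky kz, shape g.-1 (branch x y) y ky /\
                          shape g.-1 (branch x z) z kz) ->
  exists k, shape g (fork x y z) x k.
Proof.
move=> xy xz yNz r_y r_z hx IH.
have hy := height_child xy r_y; have hz := height_child xz r_z.
have f_y v : v \in branch x y -> v \in fork x y z.
  by move=> v_y; rewrite !in_setU v_y orbT.
have f_z v : v \in branch x z -> v \in fork x y z.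
  by move=> v_z; rewrite !in_setU v_z !orbT.
case: g hx IH => [|g] hx IH.
  have pend u : adj x u -> height r u = (height r x).+1 -> branch x u = [set u].
    move=> xu hu; apply: branch_pendant => //; apply: deepest_pendant.
      by rewrite height_neq_root // hu.
    by rewrite hu -hx addn1.
  exists 1; split=> //=.
  - by rewrite card_fork // !pend // !cards1.
  - have -> : opt 1 = 5 by rewrite (@opt_balanced 0 0) //; exists 0.
    by rewrite nrooted_fork // /fcount !pend // !nrooted1.
  - split=> // /(_ y (f_y y (branch_root x y))) []; rewrite hy -hx; lia.
have [//|ky [kz [[cy ny by1 [dy1 dy2] ey] [cz nz bz1 [dz1 dz2] ez]]]] := IH.
move: by1 dy1 dy2 ey bz1 dz1 dz2 ez => /= by1 dy1 dy2 ey bz1 dz1 dz2 ez.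
have lt_y : height r y < H by rewrite hy -hx !addnS !ltnS leq_addr.
(* If the earlier branch reaches level H, it contains a parent of a deepest vertex. The vertices at
   level H - 1 of the later branch follow it in the order, so by the final segment condition they
   are such parents too. *)
have one u w ku : adj x u -> adj x w -> u != w -> r \in branch u x ->
    r \in branch w x -> le u w ->
    ((forall v, v \in branch x u -> height r v <> H) -> ku.+1 = 2 ^ g) ->
    ku.+1 = 2 ^ g \/
    (forall v, v \in branch x w -> height r v = H.-1 -> ~~ pendant v).
  move=> xu xw uNw r_u r_w le_uw none.
  have [ex|] := boolP [exists v in branch x u, height r v == H]; last first.
    rewrite negb_exists_in => /forall_inP no; left; apply: none => v v_u.
    by apply/eqP; apply: no.
  right; move: ex => /exists_inP[v v_u /eqP hv] w' w'_w hw'.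
  have [|q q_u [q_D hq]] := deepest_parent xu r_u _ v_u hv.
    by rewrite (height_child xu r_u) -hy.
  have le_qw := ordering_branch xu xw uNw r_u r_w le_uw q_u w'_w.
  have w'_D : w' \in parents_of_deepest r.
    by apply: le_deepest q_D (le_qw _); rewrite ?inE ?hq ?hw'.
  apply: deepest_parent_nonpendant w'_D; apply: height_neq_root.
  by rewrite hw' -hx !addnS.
have bal : balanced ky kz.
  exists g => //.
  have [le_tot _ _ _] : [/\ {in level r (height r y) &, total le}, True, True & True].
    by have [] := @le_ordering (height r y); rewrite ?hy.
  have := le_tot y z; rewrite !inE hy hz eqxx => /(_ isT isT)/orP[le_yz|le_zy].
    have [->|/ez->] := one y z ky xy xz yNz r_y r_z le_yz dy2; by rewrite eqxx ?orbT.
  rewrite eq_sym in yNz.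
  have [->|/ey->] := one z y kz xz xy yNz r_z r_y le_zy dz2; by rewrite eqxx ?orbT.
exists (ky + kz).+1; split.
- by rewrite card_fork // cy cz; lia.
- by rewrite nrooted_fork // /fcount ny nz opt_balanced.
- by rewrite !expnS in by1 bz1 *; lia.
- split=> [[v v_f hv]|no].
    have vNx : v != x by apply: contra_eqN hv => /eqP->; rewrite -hx; lia.
    have [[v_y _]|[v_z _]] := dist_fork treeR xy xz v_f vNx.
      by have := dy1 (ex_intro2 _ _ v v_y hv); rewrite expnS; lia.
    by have := dz1 (ex_intro2 _ _ v v_z hv); rewrite expnS; lia.
  have -> : ky = (2 ^ g).-1 by rewrite -dy2 // => v /f_y; apply: no.
  have -> : kz = (2 ^ g).-1 by rewrite -dz2 // => v /f_z; apply: no.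
  by have := expn_gt0 2 g; rewrite expnS /=; lia.
- move=> all_np; have := ey (fun v v_y => all_np v (f_y v v_y)).
  have := ez (fun v v_z => all_np v (f_z v v_z)).
  by rewrite [2 ^ g.+2]expnS; lia.
Qed.

Lemma shape_branch g p x : adj p x -> r \in branch x p ->
  height r x + g.+1 = H -> exists k, shape g (branch p x) x k.
Proof.
elim: g p x => [|g IHg] p x px r_p hx.
all: have xp : adj x p by rewrite adj_sym.
all: have [pend|npend] := boolP (pendant x); last first.
all: try (have [y [z [yNz [yNp zNp] xy xz nbr]]] := nonpendant_nbrs px r_p npend;
  have r_y := child_branch px r_p xy yNp;
  have r_z := child_branch px r_p xz zNp;
  rewrite (fork_branch treeR xp xy xz yNp zNp nbr);
  apply: shape_fork => //= _).
(* Leaves occur only at levels H - 1 and H, so x can be a leaf only for g = 0. *)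
- exists 0; rewrite branch_pendant //; split=> //=.
  + by rewrite cards1.
  + by rewrite nrooted1.
  + split=> // -[v /set1P->]; rewrite -hx; lia.
  + by move=> /(_ x (set11 x)); rewrite pend -hx addn1 => /(_ erefl).
- have hy := height_child xy r_y; have hz := height_child xz r_z.
  have [|ky sy] := IHg _ _ xy r_y; first by rewrite hy -hx; lia.
  have [|kz sz] := IHg _ _ xz r_z; first by rewrite hz -hx; lia.
  by exists ky, kz.
- by have := @shallow_nonpendant x; rewrite pend -hx; lia.
Qed.

Lemma rgood_shape : exists k, [/\ #|R| = k.*2.+1, (nb_subtrees r).+1 = opt k
  & 2 ^ H <= k.*2].
Proof.
have [y [z [yNz ry rz nbr]]] := degree2P degree_root.
have [||||k [cR nR bR [ex _] _]] := @shape_fork H.-1 r y z ry rz yNz.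
- exact: branch_root.
- exact: branch_root.
- by rewrite height_root prednK // max_height_gt0.
- move=> H_gt1; have hy := height_child ry (branch_root y r).
  have hz := height_child rz (branch_root z r).
  have [|ky sy] := @shape_branch H.-2 r y ry (branch_root y r).
    by rewrite hy height_root; lia.
  have [|kz sz] := @shape_branch H.-2 r z rz (branch_root z r).
    by rewrite hz height_root; lia.
  by exists ky, kz.
rewrite -fork_setT // in cR nR bR ex.
exists k; rewrite nb_subtrees_nrooted // nR -cR cardsT; split=> //.
have [v _ hv] := deepest_exists.
have := ex (ex_intro2 _ _ v (in_setT v) hv).
by rewrite -[in 2 ^ H](prednK max_height_gt0) expnS; lia.
Qed.

End Rgood.

Lemma rgood_opt (R : sgraph) (r : R) : rgood r -> 2 < #|R| ->
  exists k, [/\ #|R| = k.*2.+1, (nb_subtrees r).+1 = opt k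
    & 2 ^ max_height r <= k.*2].
Proof.
case=> -[treeR [->//|[deg_r deg]]] pend [le ord_le deep] _.
exact: rgood_shape deep.
Qed.

(** * Existence of rgood trees *)

(* On a cycle, a vertex of maximal height has two distinct lower neighbours. *)
Lemma acyclic_height (G : sgraph) (h : G -> nat) :
  (forall x y : G, adj x y -> h x != h y) ->
  (forall x y z : G, adj x y -> adj x z -> h y < h x -> h z < h x -> y = z) ->
  acyclic G.
Proof.
move=> h_neq h_uniq c cyc_c; rewrite ltnNge; apply/negP => size_c.
have [x0 x0c] : exists x, x \in c.
  by case: c size_c {cyc_c} => // x c _; exists x; rewrite mem_head.
case: (@arg_maxnP _ x0 (mem c) h x0c) => x xc max_x.
have [i c' Ec'] := rot_to xc.
have max' v : v \in x :: c' -> h v <= h x.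
  by rewrite -Ec' mem_rot; apply: max_x.
move: cyc_c; rewrite /ucycle -(rot_cycle i) -(rot_uniq i) Ec' => /andP[].
have : 2 < size (x :: c') by rewrite -Ec' size_rot.
case: c' {Ec'} max' => // y c'; case/lastP: c' => // c' z max' _.
rewrite /= rcons_path last_rcons => /andP[xy /andP[_ zx]] /and3P[_ yNc _].
have lower v : v \in [:: x, y & rcons c' z] -> adj x v -> h v < h x.
  by move=> v_c xv; rewrite ltn_neqAle max' // eq_sym h_neq.
case/negP: yNc; rewrite (h_uniq x y z) ?mem_rcons ?mem_head // 1?adj_sym //.
  by apply: lower => //; rewrite !inE eqxx orbT.
by apply: lower; rewrite 1?adj_sym // !inE mem_rcons mem_head !orbT.
Qed.

(** Following parents lowers h down to the root, whence connectedness; the parent is the only lower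
    neighbour, whence acyclicity. *)
Lemma parent_tree (G : sgraph) (r : G) (par : G -> G) (h : G -> nat) :
  h r = 0 ->
  (forall v, v != r -> adj v (par v) /\ h v = (h (par v)).+1) ->
  (forall x y : G, adj x y -> x != r /\ y = par x \/ y != r /\ x = par y) ->
  tree G /\ forall v, height r v = h v.
Proof.
move=> h_r parP adjP.
have conn_r n v : h v = n -> connect (@adj G) v r.
  elim: n v => [|n IHn] v hv; have [->|vNr] := eqVneq v r; rewrite ?connect0 //.
    by have [_] := parP v vNr; rewrite hv.
  have [vp Ehv] := parP v vNr; apply: connect_trans (connect1 vp) (IHn _ _).
  by move: hv; rewrite Ehv => -[].
have conn : connected G.
  move=> x y; apply: connect_trans (conn_r _ _ erefl) _.
  by rewrite (sym_connect_sym (@adj_sym G)); apply: conn_r.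
have adj_h x y : adj x y -> x != r /\ y = par x /\ h x = (h y).+1 \/
    y != r /\ x = par y /\ h y = (h x).+1.
  by case/adjP => -[xNr ->]; have [_ ?] := parP _ xNr; [left|right].
split=> [|v].
  split=> //; apply: (@acyclic_height _ h) => [x y|x y z].
    by case/adj_h => -[_ [_ ->]]; lia.
  by case/adj_h => -[_ [Ey hy]] /adj_h[] [_ [Ez hz]] *; rewrite ?Ey ?Ez //; lia.
apply/eqP; rewrite eqn_leq; apply/andP; split; last first.
  rewrite -[leqRHS]add0n -h_r; apply: dist_lipschitz => // x y /adj_h[] [_ [_]]; lia.
elim: {v}(h v) {-2}v (erefl (h v)) => [|n IHn] v hv.
  have [->|/parP[_]] := eqVneq v r; first by rewrite /height dist_refl.
  by rewrite hv.
have [vr|/parP[vp Ehv]] := eqVneq v r; first by rewrite vr h_r in hv.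
rewrite /height; apply: leq_trans (dist_triangle conn r (par v) v) _.
rewrite (@dist_adj _ conn (par v) v) 1?adj_sym // addn1 Ehv ltnS; apply: IHn.
by move: hv; rewrite Ehv => -[].
Qed.

Section Heap.
Variable k : nat.
Hypothesis k_gt0 : 0 < k.

(** The rgood tree as a binary heap: the parent of i > 0 is (i - 1) / 2 rounded down, the vertices
    below k are internal, and levels are given by the binary logarithm of i + 1. *)
Definition heap_vertex : finType := 'I_k.*2.+1.
Implicit Types i j x y v : heap_vertex.

Definition heap_adj : rel heap_vertex :=
  fun i j => (0 < i) && (j == (i.-1)./2 :> nat) || (0 < j) && (i == (j.-1)./2 :> nat).

Lemma heap_sym : symmetric heap_adj.
Proof. by move=> i j; rewrite /heap_adj orbC. Qed.

Lemma heap_irr : irreflexive heap_adj.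
Proof. by move=> i; rewrite /heap_adj orbb; apply/negP => /andP[]; lia. Qed.

Definition heap := SGraph heap_sym heap_irr.
Definition heap_root : heap := ord0.
Definition heap_parent i : heap_vertex := inord (i.-1)./2.
Definition heap_height i := trunc_log 2 i.+1.

Lemma heap_parentE i : heap_parent i = (i.-1)./2 :> nat.
Proof. by rewrite inordK //; have := ltn_ord i; lia. Qed.

Lemma heap_neq_root i : (i != heap_root) = (0 < i).
Proof. by rewrite -val_eqE /= lt0n. Qed.

Lemma heap_heightE i : 0 < i -> heap_height i = (trunc_log 2 ((i.-1)./2).+1).+1.
Proof.
move=> i_gt0; rewrite /heap_height trunc_log2S; last by lia.
by congr (trunc_log 2 _).+1; lia.
Qed.

Lemma heap_tree : tree heap /\ forall v, height heap_root v = heap_height v.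
Proof.
apply: (@parent_tree heap heap_root heap_parent) => [|v|x y].
- by rewrite /heap_height trunc_log1.
- rewrite heap_neq_root => v_gt0.
  by rewrite /= /heap_adj v_gt0 heap_parentE eqxx heap_heightE // /heap_height
     heap_parentE.
rewrite !heap_neq_root => /orP[/andP[x_gt0 /eqP Ey]|/andP[y_gt0 /eqP Ex]].
  by left; split=> //; apply: val_inj; rewrite /= heap_parentE.
by right; split=> //; apply: val_inj; rewrite /= heap_parentE.
Qed.

Lemma heap_heightP v : height heap_root v = heap_height v.
Proof. exact: heap_tree.2. Qed.

Lemma heap_degree_root : degree heap_root = 2.
Proof.
have lt1 : 1 < k.*2.+1 by lia.
have lt2 : 2 < k.*2.+1 by lia.
rewrite /degree (_ : [set w | adj heap_root w] = [set Ordinal lt1; Ordinal lt2]) ?cards2 //.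
by apply/setP => w; rewrite !inE -!val_eqE /= /heap_adj /=; lia.
Qed.

Lemma heap_degree_leaf v : k <= v -> degree (v : heap) = 1.
Proof.
move=> le_v; rewrite /degree (_ : [set w | adj (v : heap) w] = [set heap_parent v]) ?cards1 //.
apply/setP => w; rewrite !inE -val_eqE /= heap_parentE /heap_adj /=.
by have := ltn_ord w; lia.
Qed.

Lemma heap_degree_node v : 0 < v < k -> degree (v : heap) = 3.
Proof.
move=> Hv.
have lt1 : v.*2.+1 < k.*2.+1 by lia.
have lt2 : v.*2.+2 < k.*2.+1 by lia.
rewrite /degree (_ : [set w | adj (v : heap) w] =
  heap_parent v |: [set Ordinal lt1; Ordinal lt2]).
  rewrite cardsU1 cards2 !inE -!val_eqE /= heap_parentE; lia.
apply/setP => w; rewrite !inE -!val_eqE /= heap_parentE /heap_adj /=.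
by have := ltn_ord w; lia.
Qed.

Lemma heap_pendant v : pendant (v : heap) = (k <= v).
Proof.
rewrite /pendant; have [le_k|lt_k] := leqP k v; first by rewrite heap_degree_leaf.
have [v0|v_gt0] := posnP v; last by rewrite heap_degree_node ?v_gt0.
by rewrite (_ : v = heap_root) ?heap_degree_root //; apply: val_inj.
Qed.

Lemma heap_max_height : max_height heap_root = trunc_log 2 k.*2.+1.
Proof.
apply/eqP; rewrite eqn_leq; apply/andP; split.
  by apply/bigmax_leqP => v _; rewrite heap_heightP; apply: leq_trunc_log.
rewrite -[trunc_log _ _]/(heap_height ord_max) -heap_heightP.
exact: (leq_bigmax (F := fun v : heap => height heap_root v)).
Qed.

Lemma heap_is_parent x v : is_parent heap_root x v -> 0 < v /\ x = (v.-1)./2 :> nat.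
Proof.
rewrite /is_parent !heap_heightP => /andP[/orP[]/andP[gt0 /eqP E] /eqP hv] //.
by move: hv; rewrite (heap_heightE gt0) /heap_height -E; lia.
Qed.

Lemma heap_rgood : rgood heap_root.
Proof.
split.
- split; first exact: heap_tree.1; right; split; first exact: heap_degree_root.
  move=> v; rewrite heap_neq_root => v_gt0.
  have [/heap_degree_leaf|lt_k] := leqP k v; first by left.
  by right; apply: heap_degree_node; rewrite v_gt0.
- move=> u v; rewrite !heap_pendant !heap_heightP => le_u le_v.
  rewrite /heap_height -trunc_log2_double // leq_trunc_log //.
  by have := ltn_ord u; lia.
(* A heap fills its last level from the left, so reversing the indices makes the parents of the
   deepest vertices a final segment. *)
exists (fun x y : heap_vertex => y <= x).
  move=> j j_gt0; split.
  - by move=> x y _ _; apply: leq_total.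
  - by move=> x y _ _ E; apply: val_inj; apply/eqP; rewrite eqn_leq andbC.
  - by move=> x y z _ _ _ le1 le2; apply: leq_trans le2 le1.
  move=> x y _ _ px py /heap_is_parent[x_gt0 Ex] /heap_is_parent[y_gt0 Ey].
  by rewrite -val_eqE /= Ex Ey; lia.
move=> x y; rewrite !inE heap_max_height !heap_heightP => _ /eqP hy.
move=> /existsP[v /and3P[_ _ /heap_is_parent[v_gt0 Ex]]] le_yx.
have lt_c : y.*2.+1 < k.*2.+1 by have := ltn_ord v; lia.
have hc : heap_height (Ordinal lt_c) = trunc_log 2 k.*2.+1.
  rewrite heap_heightE //= doubleK -/(heap_height y) hy prednK //.
  by rewrite trunc_log_gt0 /=; lia.
apply/existsP; exists (Ordinal lt_c); rewrite heap_pendant heap_heightP hc eqxx /=.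
rewrite /is_parent !heap_heightP hc hy /= /heap_adj /= doubleK eqxx orbT /=.
rewrite prednK ?eqxx ?andbT; last by rewrite trunc_log_gt0 /=; lia.
(* Were 2y + 1 internal, its child 4y + 3 would exceed the maximal height. *)
rewrite leqNgt; apply/negP => lt_k.
have : trunc_log 2 (y.*2.+2).*2 <= trunc_log 2 k.*2.+1 by apply: leq_trunc_log; lia.
by rewrite trunc_log2_double // -hc /heap_height /= ltnn.
Qed.

End Heap.

Lemma is_Trg_exists k : 0 < k -> exists (R : sgraph) (r : R), is_Trg r k.*2.+1.
Proof.
move=> k_gt0; exists (heap k_gt0), (heap_root k_gt0); split; first exact: heap_rgood.
exact: card_ord.
Qed.

(** * Amalgams of two trees *)

Lemma nrooted_embed (G K : sgraph) (f : G -> K) (X : {set G}) x :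
  injective f -> (forall a b, adj (f a) (f b) = adj a b) ->
  nrooted (f @: X) (f x) = nrooted X x.
Proof.
move=> f_inj f_adj; rewrite /nrooted -(card_imset _ (imset_inj f_inj)).
have ind (S : {set G}) a b : induced (f @: S) (f a) (f b) = induced S a b.
  by rewrite /induced f_adj !mem_imset.
apply: eq_card => S; apply/rooted_setsP/imsetP => [[sub xS connS]|[A]].
  have ES : S = f @: (f @^-1: S).
    apply/setP => a; apply/idP/imsetP => [aS|[b]]; last by rewrite inE => bS ->.
    have /imsetP[b _ Ea] := subsetP sub a aS.
    by exists b; rewrite // inE -Ea.
  exists (f @^-1: S) => //; apply/rooted_setsP; split; last 1 first.
  - move=> a; rewrite inE => aS.
    have key b : connect (induced S) (f x) b ->
        exists2 b', b = f b' & connect (induced (f @^-1: S)) x b'.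
      move: b; apply: connect_inv => [|b c /and3P[bc bS cS] [b' Eb conn_b]].
        by exists x; rewrite ?connect0.
      have /imsetP[c' _ Ec] := subsetP sub c cS; exists c' => //.
      apply: connect_trans conn_b (connect1 _).
      by rewrite /induced -f_adj !inE -Eb -Ec bc bS.
    by have [b /f_inj <-] := key _ (connS _ aS).
  - apply/subsetP => a; rewrite inE => /(subsetP sub).
    by rewrite mem_imset.
  - by rewrite inE.
move=> /rooted_setsP[sub xA connA] ->; split; first exact: imsetS.
  by rewrite mem_imset.
move=> _ /imsetP[a aA ->].
move: a {aA}(connA a aA); apply: connect_inv => [|a b ab]; first exact: connect0.
by move=> conn_a; apply: connect_trans conn_a (connect1 _); rewrite ind.
Qed.

Lemma dist_homo (G K : sgraph) (f : G -> K) (a b : G) :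
  connected G -> connected K ->
  (forall x y, adj x y -> f x = f y \/ adj (f x) (f y)) ->
  dist (f a) (f b) <= dist a b.
Proof.
move=> connG connK f_adj.
rewrite -[leqRHS]add0n -(dist_refl (f a)).
apply: (dist_lipschitz connG (f := fun x => dist (f a) (f x))) => x y /f_adj[->//|xy].
by rewrite -addn1 -(dist_adj connK xy) dist_triangle.
Qed.

Section TreeHeight.
Variables (G : sgraph) (r : G).
Hypothesis treeG : tree G.

Lemma adj_dist_neq x y : adj x y -> dist r x != dist r y.
Proof.
move=> xy; have yx : adj y x by rewrite adj_sym.
have [r_y|r_x] := boolP (r \in branch x y).
  rewrite (dist_branch treeG yx r_y (branch_root y x)) dist_refl; lia.
rewrite -branchC // in r_x.
rewrite (dist_branch treeG xy r_x (branch_root x y)) dist_refl; lia.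
Qed.

Lemma lower_uniq x y z : adj x y -> adj x z -> dist r y < dist r x ->
  dist r z < dist r x -> y = z.
Proof.
have low u : adj x u -> dist r u < dist r x -> r \in branch x u.
  move=> xu; apply: contraLR; rewrite -branchC // => r_x.
  by rewrite (dist_branch treeG xu r_x (branch_root x u)); lia.
move=> xy xz /(low _ xy) r_y /(low _ xz) r_z; exact: branch_disj r_y r_z.
Qed.
End TreeHeight.

(** A walk that avoids the only edge between X and Y stays on its side. *)
Lemma branch_partition (G : sgraph) (x y : G) (X Y : {set G}) : tree G ->
  adj x y -> x \in X -> y \in Y -> [disjoint X & Y] -> (forall v, v \in X \/ v \in Y) ->
  (forall a b, a \in X -> b \in Y -> adj a b -> a = x /\ b = y) ->
  branch x y = Y /\ branch y x = X.
Proof.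
move=> treeG xy xX yY disj cover edge.
have sub_Y v : v \in branch x y -> v \in Y.
  rewrite inE; move: v; apply: connect_inv => // a b /andP[ab nab] aY.
  have [bX|//] := cover b; rewrite adj_sym in ab.
  by have [Eb Ea] := edge _ _ bX aY ab; rewrite Eb Ea !eqxx orbT in nab.
have sub_X v : v \in branch y x -> v \in X.
  rewrite inE; move: v; apply: connect_inv => // a b /andP[ab nab] aX.
  have [//|bY] := cover b.
  by have [Ea Eb] := edge _ _ aX bY ab; rewrite Eb Ea !eqxx orbT in nab.
split; apply/setP => v; apply/idP/idP; first exact: sub_Y; last 2 first.
- exact: sub_X.
- by move=> vX; rewrite branchC //; apply/negP => /sub_Y;
    rewrite (disjointFr disj vX).
move=> vY; apply: contraT; rewrite -branchC // => /sub_X vX.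
by rewrite (disjointFr disj vX) in vY.
Qed.

Section IdentifyTrees.
Variables (C R : sgraph) (u : C) (r : R).
Hypotheses (treeC : tree C) (treeR : tree R).
Let G := identify u r.

Definition from_left (x : C) : G := inl x.

Definition from_right (x : R) : G :=
  if insub x is Some y then inr y else inl u.

(** A retraction that collapses the copy of R to u; it does not increase distances. *)
Definition to_left (a : G) : C := if a is inl x then x else u.

Definition to_right (a : G) : R := if a is inr y then val y else r.

Lemma from_right_root : from_right r = inl u.
Proof. by rewrite /from_right insubF ?eqxx. Qed.

Lemma from_rightE (y : {x : R | x != r}) : from_right (val y) = inr y.
Proof. by rewrite /from_right valK. Qed.

Variant right_spec (x : R) : G -> Prop :=
| RightRoot of x = r : right_spec x (inl u)
| RightVal (y : {x : R | x != r}) of x = val y : right_spec x (inr y).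

Lemma from_rightP x : right_spec x (from_right x).
Proof.
have [->|xNr] := eqVneq x r; first by rewrite from_right_root; constructor.
by have := from_rightE (Sub x xNr); rewrite SubK => ->; constructor; rewrite SubK.
Qed.

Lemma from_rightK : cancel from_right to_right.
Proof. by move=> x; case: from_rightP => [->|y ->]. Qed.

Lemma adj_from_right x y : adj (from_right x) (from_right y) = adj x y.
Proof.
case: from_rightP => [->|x' ->]; case: from_rightP => [->|y' ->] //=.
- by rewrite !adj_irr.
- by rewrite eqxx.
- by rewrite eqxx adj_sym.
Qed.

Lemma to_left_from_right x : to_left (from_right x) = u.
Proof. by case: from_rightP. Qed.

Lemma identify_cover a : (exists x, a = from_left x) \/ (exists x, a = from_right x).
Proof. by case: a => [x|y]; [left; exists x | right; exists (val y); rewrite from_rightE]. Qed.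

Lemma adj_to_left a b : adj a b -> to_left a = to_left b \/ adj (to_left a) (to_left b).
Proof.
case: a b => [x|x] [y|y] /=; try by left.
- by right.
- by case/andP => /eqP-> _; left.
- by case/andP => /eqP-> _; left.
Qed.

Lemma identify_connected : connected G.
Proof.
have sym := sym_connect_sym (@adj_sym G).
have left_conn x : connect (@adj G) (inl u) (inl x).
  move: x (treeC.1 u x); apply: connect_inv => [|x y xy]; first exact: connect0.
  by move/connect_trans; apply; apply: connect1.
have right_conn x : connect (@adj G) (inl u) (from_right x).
  rewrite -from_right_root; move: x (treeR.1 r x).
  apply: connect_inv => [|x y xy]; first exact: connect0.
  by move/connect_trans; apply; apply: connect1; rewrite adj_from_right.
have all_conn a : connect (@adj G) (inl u) a.
  by have [[x ->]|[x ->]] := identify_cover a.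
by move=> a b; apply: connect_trans (all_conn b); rewrite sym.
Qed.

Lemma identify_tree : tree G.
Proof.
split; first exact: identify_connected.
have connC := treeC.1; have connR := treeR.1.
(* The distance to the merged vertex, computed within each of the two trees. *)
pose h (a : G) := match a with inl x => dist u x | inr y => dist r (val y) end.
have pos (y : {x : R | x != r}) : 0 < dist r (val y).
  by rewrite lt0n dist_eq0 // eq_sym; case: y.
apply: (acyclic_height (h := h)) => [[x|x] [y|y]|[x|x] [y|y] [z|z]] //=.
- exact: adj_dist_neq.
- by case/andP => /eqP-> _; rewrite dist_refl // neq_ltn pos.
- by case/andP => /eqP-> _; rewrite dist_refl // neq_ltn pos orbT.
- exact: adj_dist_neq.
- by move=> xy xz ly lz; rewrite (lower_uniq treeC xy xz ly lz).
- by move=> _ /andP[/eqP-> _]; rewrite dist_refl.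
- by move=> /andP[/eqP-> _] _; rewrite dist_refl.
- by move=> /andP[/eqP-> _] _; rewrite dist_refl.
- by move=> /andP[/eqP-> _] /andP[/eqP-> _].
- by move=> /andP[/eqP-> rx] _ _; rewrite (dist_adj connR rx) ltnS leqNgt pos.
- by move=> _ /andP[/eqP-> rx]; rewrite (dist_adj connR rx) ltnS leqNgt pos.
- by move=> xy xz ly lz; congr inr; apply: val_inj; apply: lower_uniq ly lz.
Qed.

Lemma dist_from_left x y : dist (from_left x) (from_left y) = dist x y.
Proof.
apply/eqP; rewrite eqn_leq; apply/andP; split.
  apply: dist_homo => [||a b ab]; [exact: treeC.1|exact: identify_connected|by right].
apply: (@dist_homo G C to_left (inl x) (inl y)); [exact: identify_connected|exact: treeC.1|].
exact: adj_to_left.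
Qed.

Lemma dist_to_left a b : dist (to_left a) (to_left b) <= dist a b.
Proof.
by apply: dist_homo => [||? ? /adj_to_left//]; [exact: identify_connected|exact: treeC.1].
Qed.

Lemma dist_from_right x y : dist (from_right x) (from_right y) <= dist x y.
Proof.
apply: dist_homo => [||a b ab]; [exact: treeR.1|exact: identify_connected|right].
by rewrite adj_from_right.
Qed.

(** * Center and subtree core of an amalgam at a pendant vertex *)

Section AtLeaf.
Variable w : C.
Hypotheses (uw : adj u w) (pend_u : pendant u).

Lemma branch_leaf : branch u w = ~: [set u].
Proof.
apply/setP => v; rewrite in_setC1; have [->|vNu] := eqVneq v u.
  by rewrite (negPf (branch_parent treeC uw)).
have [|y uy v_y] := @branch_next _ treeC u v; first by rewrite eq_sym.
by rewrite (pendant_adj pend_u uw uy).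
Qed.

Lemma branch_identify :
  branch (from_left u) (from_left w) = from_left @: branch u w /\
  branch (from_left w) (from_left u) = from_right @: setT.
Proof.
have inlI : injective from_left by move=> x y [].
have wNu : w != u by apply: contraTneq uw => ->; rewrite adj_irr.
have right_u : from_left u \in from_right @: setT.
  by apply/imsetP; exists r; rewrite // from_right_root.
apply: branch_partition => //.
- exact: identify_tree.
- by rewrite mem_imset // branch_root.
- rewrite -setI_eq0; apply/eqP/setP => a; rewrite in_setI in_set0.
  apply/negP => /andP[/imsetP[x _ ->] /imsetP[y]].
  rewrite branch_leaf in_setC1 => yNu.
  by case: from_rightP => // _ [Eu]; rewrite Eu eqxx in yNu.
- move=> a; have [[x ->]|[x ->]] := identify_cover a; last first.
    by left; apply: imset_f.
  have [->|xNu] := eqVneq x u; first by left.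
  by right; rewrite mem_imset // branch_leaf in_setC1.
move=> a b /imsetP[x _ ->] /imsetP[y]; rewrite branch_leaf in_setC1 => yNu ->.
case: from_rightP => [_|x' _] /=; last by rewrite (negPf yNu).
by move=> uy; rewrite (pendant_adj pend_u uw uy).
Qed.

Lemma fcount_left : fcount (from_left u) (from_left w) = fcount u w.
Proof.
rewrite /fcount branch_identify.1; apply: nrooted_embed => //.
by move=> x y [].
Qed.

Lemma fcount_right : fcount (from_left w) (from_left u) = nb_subtrees r.
Proof.
rewrite /fcount branch_identify.2 nb_subtrees_nrooted //.
rewrite [from_left u](esym from_right_root); apply: nrooted_embed.
  exact: can_inj from_rightK.
exact: adj_from_right.
Qed.

(* The vertex at distance d from u on a longest path of C has eccentricity at
   most ecc u - d in the amalgam. *)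
Lemma center_core_dist d c s : (forall v : C, ecc v <= ecc u) ->
  fcount u w < nb_subtrees r -> d.*2 + max_height r <= ecc u ->
  c \in center G -> s \in subtree_core G -> d <= dist c s.
Proof.
move=> max_u lt_f le_d c_cen s_core.
have connC := treeC.1; have connG := identify_connected.
(* The branch at w has fewer rooted subtrees than R, so no core vertex lies in it. *)
have [x Es] : exists x, s = from_right x.
  have [|[y Es]//] := identify_cover s; last by exists y.
  case=> y Es; have [y_eq|yNu] := eqVneq y u.
    by exists r; rewrite Es y_eq from_right_root.
  have := subtree_core_branch identify_tree _ _ s_core (u := from_left u) (w := from_left w).
  rewrite fcount_left fcount_right => /(_ uw lt_f) /negP[].
  by rewrite branch_identify.1 Es mem_imset ?branch_leaf ?in_setC1 // => ? ? [].
rewrite leqNgt; apply/negP => lt_d.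
have [z Ez] := eccP u; rewrite dist_sym // in Ez.
have [m um mz] : exists2 m, dist u m = d & dist m z = ecc u - d.
  have mid i : i <= ecc u -> exists2 m, dist u m = i & dist m z = ecc u - i.
    elim: i => [|i IHi] lt_i; first by exists u; rewrite ?dist_refl ?subn0.
    have [m um mz] := IHi (ltnW lt_i).
    have [|m' mm' Em] := @dist_next _ connC m z.
      by rewrite -dist_eq0 // mz; lia.
    exists m'; last by lia.
    have := dist_triangle connC u m m'; have := dist_triangle connC u m' z.
    by rewrite (dist_adj connC mm') Ez; lia.
  by apply: mid; lia.
have ecc_m : ecc (from_left m) <= ecc u - d.
  apply/bigmax_leqP => a _; have [[v ->]|[v ->]] := identify_cover a; last first.
    (* Vertices of R are within [max_height r + d] of m, which [le_d] bounds by [ecc u - d]. *)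
    apply: leq_trans (dist_triangle connG _ (from_left u) _) _.
    rewrite dist_from_left um.
    have := dist_from_right v r; rewrite from_right_root => le_v.
    have : dist v r <= max_height r.
      rewrite dist_sym; last exact: treeR.1.
      exact: (leq_bigmax (F := height r)).
    by move: le_v; rewrite /from_left; lia.
  rewrite dist_from_left dist_sym //.
  have [->|vNm] := eqVneq v m; first by rewrite dist_refl.
  have [|y my v_y] := @branch_next _ treeC m v; first by rewrite eq_sym.
  rewrite (dist_branchl treeC my v_y).
  have le_ecc (a1 b1 : C) : dist a1 b1 <= ecc u by apply: leq_trans (dist_ecc _ _) (max_u _).
  (* As m lies between u and z, the branch at m holding v misses one of them. The path from that end
     to v passes through m and has length at most [ecc u]. *)
  have [u_y|] := boolP (u \in branch m y); last first.
    rewrite -branchC // => u_m; have := le_ecc u v.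
    by rewrite (dist_branch treeC my u_m v_y); lia.
  have [z_y|] := boolP (z \in branch m y).
    have := dist_triangle connC u y z; rewrite Ez.
    have := dist_branchl treeC my z_y; have := dist_branchl treeC my u_y.
    by rewrite (dist_sym connC m u) (dist_sym connC y u); lia.
  rewrite -branchC // => z_m; have := le_ecc z v.
  by rewrite (dist_branch treeC my z_m v_y) (dist_sym connC z m); lia.
(* The projection of c to C is closer than d to u, hence farther than [ecc u - d] from z, so c has
   larger eccentricity than m. *)
have : ecc c <= ecc (from_left m) by move: c_cen; rewrite inE => /forallP.
have := dist_ecc (from_left z) c.
have := dist_to_left (from_left z) c; have := dist_to_left c s.
rewrite Es to_left_from_right -Es /=.
have := dist_triangle connC u (to_left c) z.
rewrite Ez (dist_sym connC u (to_left c)) (dist_sym connC z (to_left c)); lia.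
Qed.

End AtLeaf.
End IdentifyTrees.

(** * Binary caterpillars *)

Section Caterpillar.
Variable C : sgraph.
Implicit Types (x y v w : C) (p : seq C).

Lemma dist_uniq_path x p : tree C -> path (@adj C) x p -> uniq (x :: p) ->
  dist x (last x p) = size p.
Proof.
move=> treeC; elim: p x => [|y p IHp] x; first by rewrite dist_refl.
move=> /= /andP[xy path_p] /andP[xNp uniq_p].
rewrite (dist_branchl treeC xy) ?IHp // inE; apply/connectP; exists p => //.
have key q y0 : path (@adj C) y0 q -> x \notin y0 :: q -> path (cut x y) y0 q.
  elim: q y0 => //= z q IHq y0 /andP[yz path_q]; rewrite in_cons negb_or.
  move=> /andP[xNy0 xNq]; rewrite IHq // andbT /cut yz eq_sym (negPf xNy0) /=.
  by apply: contra xNq => /andP[_ /eqP->]; apply: mem_head.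
exact: key.
Qed.

Definition spanning x p := [/\ path (@adj C) x p, uniq (x :: p) &
  forall v, v \notin x :: p -> exists2 w, w \in x :: p & adj v w].

Lemma spanning_extend x p v : spanning x p -> v \notin x :: p -> adj x v ->
  spanning v (x :: p).
Proof.
move=> [path_p uniq_p span] vNp xv; split.
- by rewrite /= adj_sym xv.
- by rewrite cons_uniq vNp.
move=> y; rewrite in_cons negb_or => /andP[_ /span[w w_p yw]].
by exists w; rewrite // in_cons w_p orbT.
Qed.

Lemma spanning_rev x p : spanning x p ->
  spanning (last x p) (rev (belast x p)).
Proof.
have E : last x p :: rev (belast x p) = rev (x :: p).
  by rewrite [x :: p]lastI rev_rcons.
move=> [path_p uniq_p span]; split.
- by rewrite rev_path (eq_path (e' := @adj C)) // => a b /=; apply: adj_sym.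
- by rewrite E rev_uniq.
move=> y; rewrite E mem_rev => /span[w w_p yw].
by exists w; rewrite // mem_rev.
Qed.

(** The spine is extended at its first vertex, or after reversal at its last, until both ends have
    all their neighbours on it. *)
Lemma spanning_maximal x p : spanning x p -> exists x p, [/\ spanning x p,
  forall v, adj x v -> v \in x :: p & forall v, adj (last x p) v -> v \in x :: p].
Proof.
have [n le_n] := ubnP (#|C| - size p).
elim: n x p le_n => // n IHn x p le_n span_p.
have extend y q v : spanning y q -> size q = size p -> v \notin y :: q ->
    adj y v -> exists x p, [/\ spanning x p,
  forall v, adj x v -> v \in x :: p & forall v, adj (last x p) v -> v \in x :: p].
  move=> span_q size_q vNq yv; apply: IHn (spanning_extend span_q vNq yv).
  have [_ uniq_q _] := span_q.
  have : size (y :: q) <= #|C| by rewrite -(card_uniqP uniq_q) max_card.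
  by move: le_n; rewrite /= size_q; move: #|C| => c; lia.
have [/existsP[v /andP[xv vNp]]|] := boolP [exists v, adj x v && (v \notin x :: p)].
  exact: extend vNp xv.
rewrite negb_exists => /forallP no_x.
have [/existsP[v /andP[xv vNp]]|] :=
    boolP [exists v, adj (last x p) v && (v \notin x :: p)].
  apply: extend (spanning_rev span_p) _ _ xv; first by rewrite size_rev size_belast.
  by move: vNp; rewrite -mem_rev [x :: p]lastI rev_rcons.
rewrite negb_exists => /forallP no_last; exists x, p; split=> // v xv.
  by have := no_x v; rewrite xv negbK.
by have := no_last v; rewrite xv negbK.
Qed.

(** On a maximal spine with q edges, the vertices off the spine are attached to distinct inner
    vertices, so there are at most q - 1 of them and at most 2q vertices in all. *)
Lemma caterpillar_diameter : binary_caterpillar C -> 1 < #|C| ->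
  exists x y : C, #|C| <= (dist x y).*2.
Proof.
case=> -[treeC deg] [x0 [p0 span0]] C_gt1.
have [x [p [[path_p uniq_p span] nbr_x nbr_last]]] := spanning_maximal span0.
exists x, (last x p); rewrite dist_uniq_path //.
have degree_le v : degree v <= 3.
  by have [/eqP->|/deg->] := boolP (pendant v).
have p_neq0 : p != [::].
  apply: contraTneq C_gt1 => p0'; rewrite -leqNgt; rewrite p0' in nbr_x.
  rewrite -(cards1 x) -cardsT subset_leq_card //; apply/subsetP => v _.
  have [->|xNv] := eqVneq x v; first exact: set11.
  have [y xy _] := branch_next treeC xNv.
  by have := nbr_x y xy; rewrite mem_seq1 => /eqP Ey; rewrite Ey adj_irr in xy.
have lastNx : last x p != x.
  by case: (p) p_neq0 uniq_p => // y q _ /= /andP[+ _]; apply: contraNneq => <-;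
    rewrite mem_last.
pose P := [set v in x :: p].
have card_P : #|P| = (size p).+1 by rewrite cardsE (card_uniqP uniq_p).
pose att v := odflt x [pick w in P | adj v w].
have attP v : v \in ~: P -> att v \in P /\ adj v (att v).
  rewrite in_setC in_set => /span[w w_p vw]; rewrite /att.
  case: pickP => [w' /andP[]//|/(_ w)]; by rewrite vw in_set w_p.
have att_inner v : v \in ~: P -> att v \in P :\: [set x; last x p].
  move=> vNP; have [a_P va] := attP v vNP; rewrite in_setD a_P andbT in_set2.
  rewrite adj_sym in va; rewrite in_setC in_set in vNP; apply: contra vNP.
  by case/orP => /eqP Ea; rewrite Ea in va; [apply: nbr_x | apply: nbr_last].
have att_inj : {in ~: P &, injective att}.
  (* An inner vertex w with two attached vertices would have four neighbours: these two and its
     neighbours a and b on the spine. *)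
  move=> v1 v2 v1NP v2NP Ea; apply/eqP; apply: contraT => v1Nv2.
  have [_ va1] := attP _ v1NP; have [_ va2] := attP _ v2NP.
  have := att_inner _ v1NP; rewrite Ea in va1 *; move: (att v2) va1 va2 => w va1 va2.
  rewrite !inE negb_or => /andP[/andP[wNx wNlast]]; rewrite (negPf wNx) /= => w_p.
  have := degree_le w; rewrite leqNgt => /negP[].
  rewrite in_setC in_set in v1NP; rewrite in_setC in_set in v2NP.
  case/splitPr: w_p v1NP v2NP path_p uniq_p wNlast {Ea nbr_last p_neq0 lastNx} => p1 [|b p2].
    by rewrite last_cat /= eqxx.
  rewrite !in_cons !mem_cat !in_cons !negb_or cat_path /=.
  move=> /and3P[v1x v1p1 /and3P[v1w v1b _]] /and3P[v2x v2p1 /and3P[v2w v2b _]].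
  move=> /andP[_ /and3P[aw wb _]] uniq_q _.
  set a := last x p1 in aw.
  have a_q : a \in x :: p1 by rewrite mem_last.
  have aNb : a != b.
    move: uniq_q; rewrite -cons_uniq -cat_cons cat_uniq => /and3P[_ /hasPn nq _].
    by have := nq b; rewrite !inE eqxx orbT => /(_ isT); apply: contraNneq => <-.
  have aNv v : v != x -> v \notin p1 -> v != a.
    move=> vx vp1; apply: contraTneq a_q => <-; by rewrite inE negb_or vx.
  have uniq4 : uniq [:: v1; v2; a; b].
    by rewrite /= !inE !negb_or v1Nv2 v1b v2b aNb !aNv.
  rewrite -[4]/(size [:: v1; v2; a; b]) -(card_uniqP uniq4) subset_leq_card //.
  apply/subsetP => v; rewrite !inE => /or4P[]/eqP-> //; by rewrite adj_sym.
have : #|~: P| <= #|P :\: [set x; last x p]|.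
  rewrite -(card_in_imset att_inj) subset_leq_card //.
  by apply/subsetP => _ /imsetP[v vNP ->]; apply: att_inner.
have -> : #|P :\: [set x; last x p]| = (size p).-1.
  rewrite cardsD (setIidPr _) ?cards2 1?eq_sym ?lastNx ?card_P ?subn2 //.
  by apply/subsetP => v /set2P[]->; rewrite inE ?mem_head ?mem_last.
have := cardsC P; rewrite card_P; case: (p) p_neq0 => //= ? ? _; lia.
Qed.

End Caterpillar.

(** Let z be farthest from u. A non-pendant u has a neighbour that is not towards z, and this one is
    farther from z than u is. *)
Lemma max_ecc_pendant (C : sgraph) (u : C) : binary_tree C -> 1 < #|C| ->
  (forall v : C, ecc v <= ecc u) -> pendant u.
Proof.
move=> [treeC deg] C_gt1 max_u; have conn := treeC.1.
have [z Ez] := eccP u; apply: contraT => npend.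
have zNu : u != z.
  apply: contraTneq C_gt1 => Eu; rewrite -leqNgt -(cards1 u) -cardsT.
  apply/subset_leq_card/subsetP => v _; rewrite inE -(dist_eq0 conn) -leqn0.
  by apply: leq_trans (dist_ecc v u) _; rewrite -Ez -Eu dist_refl.
have [y uy z_y] := branch_next treeC zNu.
have [y' [_ [_ [y'Ny _] uy' _ _]]] := degree3P (deg u npend) uy.
have z_u : z \in branch y' u.
  by apply: subsetP z_y; apply: branch_sub; rewrite // eq_sym.
have := leq_trans (dist_ecc z y') (max_u y').
by rewrite (dist_branch treeC uy' z_u (branch_root u y')) dist_refl Ez; lia.
Qed.

(** * The extremal distance *)

(* a and b are the branches at the edge leading from s towards c, on the side
   of c and on the side of s respectively. *)
Lemma center_core_split (T : sgraph) (c s : T) : binary_tree T ->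
  c \in center T -> s \in subtree_core T -> 0 < dist c s ->
  (forall c' s', c' \in center T -> s' \in subtree_core T ->
     dist c s <= dist c' s') ->
  exists a b, [/\ #|T| = (internal a + internal b).+1.*2, bcount a < bcount b
                & (dist c s).*2 + bheight b <= (bheight a).+1].
Proof.
move=> [treeT deg] c_cen s_core cs_gt0 min_cs; have conn := treeT.1.
have cNs : c != s by rewrite -(dist_eq0 conn) -lt0n.
have [v1 cv1 Ecs] := dist_next conn cNs.
have s_v1 : s \in branch c v1.
  apply: contraT; rewrite -branchC // => s_c; have v1c : adj v1 c by rewrite adj_sym.
  by have := dist_branchl treeT v1c s_c; lia.
have lt_ecc : ecc c < ecc v1.
  have : v1 \notin center T.
    by apply/negP => /min_cs/(_ s_core); rewrite Ecs ltnn.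
  rewrite !inE in c_cen *; rewrite negb_forall => /existsP[u]; rewrite -ltnNge.
  by apply: leq_ltn_trans; apply: (forallP c_cen).
(* Since [ecc v1] exceeds [ecc c], a vertex z farthest from v1 lies on the side of c, at distance
   [ecc c] from c. *)
have [z Ez] := eccP v1.
have z_c : z \in branch v1 c.
  rewrite branchC //; apply/negP => z_v1; have := dist_branchl treeT cv1 z_v1.
  by have := dist_ecc z c; rewrite (dist_sym conn c z) (dist_sym conn v1 z); lia.
have Ezc : dist z c = ecc c.
  have := dist_branch treeT cv1 z_c (branch_root c v1); rewrite dist_refl Ez.
  by have := dist_ecc z c; lia.
have Ezs : dist z s = ecc c + dist c s.
  by rewrite (dist_branch treeT cv1 z_c s_v1) Ezc Ecs.
have sNc : s != c by rewrite eq_sym.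
have [y sy Esc] := dist_next conn sNc; have ys : adj y s by rewrite adj_sym.
rewrite (dist_sym conn s c) in Esc.
have c_y : c \in branch s y.
  apply: contraT; rewrite -branchC // => c_s.
  by have := dist_branchl treeT ys c_s; rewrite (dist_sym conn s c); lia.
have z_y : z \in branch s y.
  apply: contraT; rewrite -branchC // => z_s.
  have := dist_branch treeT ys c_y z_s; rewrite (dist_sym conn c z) Ezc.
  by rewrite (dist_sym conn s z) Ezs; move: cs_gt0; clear; lia.
have deg' (p x v : T) : v \in branch p x -> ~~ pendant v -> degree v = 3.
  by move=> _; apply: deg.
have [a [card_a count_a _ max_a]] := branch_btree treeT sy (@deg' s y).
have [b [card_b count_b [w w_s Ew] _]] := branch_btree treeT ys (@deg' y s).
exists a, b; split.
- by rewrite -(card_branchC treeT sy) card_a card_b; clear; lia.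
(* The neighbour y of s is nearer to c, so by minimality it is not in the core. *)
- rewrite -count_a -count_b ltnNge -leq_nb_subtrees //; apply/negP => le_sy.
  suff /(min_cs _ _ c_cen) : y \in subtree_core T.
    by rewrite Esc (dist_sym conn c y) ltnn.
  rewrite !inE in s_core *; apply/forallP => u.
  exact: leq_trans (forallP s_core u) le_sy.
(* With d the distance of c and s, the vertex z gives [ecc c + d <= (bheight a).+1], and the deepest
   vertex w of b gives [d + bheight b <= ecc c]. *)
have := max_a z z_y; have := dist_branchl treeT sy z_y.
rewrite (dist_sym conn s z) Ezs.
have := dist_branch treeT ys c_y w_s; rewrite Ew (dist_sym conn c y).
have := dist_ecc w c; rewrite (dist_sym conn w c).
by move: Esc; clear; lia.
Qed.

Theorem corollary3p10 (T : sgraph) (n l : nat)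
  (T_binary : binary_tree T) (T_card : #|T| = n) (n_ge12 : 12 <= n)
  (l_odd : odd l) (l_exceeds : Trg_exceeds n l)
  (l_least : forall m : nat, odd m -> Trg_exceeds n m -> l <= m)
  (G : sgraph) (G_crg : is_crg n l G) :
  set_dist (center T) (subtree_core T) <=
  set_dist (center G) (subtree_core G).
Proof.
have T_gt0 : 0 < #|T| by rewrite T_card; lia.
have [t0 _] := card_gt0P T_gt0.
have [c0 c0P] := center_nonempty t0; have [s0 s0P] := subtree_core_nonempty t0.
have connT := T_binary.1.1.
have [c [s [c_cen s_core Ecs]]] := set_distP connT c0P s0P; rewrite Ecs.
have [->//|cs_gt0] := posnP (dist c s).
have [|a [b [card_ab lt_ab height_ab]]] :=
    center_core_split T_binary c_cen s_core cs_gt0.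
  by move=> c' s' c'P s'P; rewrite -Ecs; apply: set_dist_le.
rewrite T_card in card_ab.
have b_gt0 : 0 < internal b.
  by case: (b) lt_ab => //=; rewrite ltnS leqn0; case: (a).
have lower_a := bcount_lower a.
(* The rgood tree with as many vertices as b has at least [bcount b] subtrees at its root, more than
   [bcount a] and hence more than the caterpillar bound for a; so its size competes with l. *)
have le_lb : l <= (internal b).*2.+1.
  apply: l_least; first by rewrite /= odd_double.
  have [R [r [R_good R_card]]] := is_Trg_exists b_gt0.
  exists R, r; split=> //; have [|k [R_card' Er _]] := rgood_opt R_good.
    by rewrite R_card; lia.
  have -> : (n - (internal b).*2.+1 - 1) %/ 2 = internal a by lia.
  have Ek : k = internal b by lia.
  by have := bcount_opt b; rewrite -Ek -Er; lia.
case: G / G_crg => C R u r n_even n_ge4 _ /andP[l_ge3 l_lt] C_cat C_card max_u.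
case=> R_good R_card.
have [[treeC degC] _] := C_cat.
have treeR : tree R by case: R_good => -[].
have [|k [R_card' Er le_H]] := rgood_opt R_good; first by rewrite R_card.
set m := (n - l - 1) %/ 2.
have l_k : l = k.*2.+1 by rewrite -R_card.
have C_card' : #|C| = m.+1.*2 by rewrite C_card /m; lia.
(* All rgood trees on l vertices have the same count at the root, one less than [opt k]. *)
have exceeds : 3 * 2 ^ m - 2 < nb_subtrees r.
  case: l_exceeds => R' [r' [[R'_good R'_card]]].
  have [|k' [R'_card' Er' _]] := rgood_opt R'_good; first by rewrite R'_card.
  have Ek : k' = k by lia.
  by rewrite Ek -Er in Er'; case: Er' => ->.
have C_gt1 : 1 < #|C| by rewrite C_card'; lia.
have pend_u := max_ecc_pendant C_cat.1 C_gt1 max_u.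
have [w uw] := pendant_exists pend_u.
have [x [y le_xy]] := caterpillar_diameter C_cat C_gt1.
have m_ecc : m < ecc u.
  by have := leq_trans (dist_ecc x y) (max_u y); lia.
have lt_f : fcount u w < nb_subtrees r.
  (* The branch of C without u has m internal vertices and height at least m, so its count is at
     most the caterpillar value. *)
  have [t [card_t -> _ max_t]] := branch_btree treeC uw (fun v _ => degC v).
  rewrite (branch_leaf treeC uw pend_u) cardsCs setCK cards1 C_card' in card_t.
  have Et : internal t = m by lia.
  have [z Ez] := eccP u.
  have z_w : z \in branch u w.
    rewrite (branch_leaf treeC uw pend_u) in_setC1 -(dist_eq0 treeC.1) Ez; lia.
  have := dist_branchl treeC uw z_w; rewrite (dist_sym treeC.1 u z) Ez => E.
  have := max_t z z_w; have := @bcount_caterpillar t; rewrite Et.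
  by move: E m_ecc exceeds; clear; lia.
have le_height : max_height r <= bheight b.
  (* A tree b of smaller height would have fewer than [2 ^ bheight b] internal vertices, too few for
     k <= [internal b]. *)
  have := internal_lt b => lt_b; rewrite leqNgt; apply/negP => lt_h.
  have : 2 ^ (bheight b).+1 <= 2 ^ max_height r by rewrite leq_exp2l.
  by rewrite expnS; move: lt_b le_H le_lb l_k; clear; lia.
have le_m : (dist c s).*2 + max_height r <= ecc u.
  (* The bound on l makes m at least [internal a], which bounds the height of a; and [ecc u] is at
     least m + 1. *)
  have le_am : internal a <= m.
    by rewrite /m leq_divRL //; move: card_ab le_lb l_lt; clear; lia.
  by have := bheight_internal a; move: le_am height_ab m_ecc le_height; clear; lia.
have [cG cG_P] := @center_nonempty (identify u r) (inl u).
have [sG sG_P] := @subtree_core_nonempty (identify u r) (inl u).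
have [c' [s' [c'P s'P ->]]] :=
  set_distP (@identify_connected C R u r treeC treeR) cG_P sG_P.
exact: (center_core_dist treeC treeR uw pend_u max_u lt_f le_m c'P s'P).
Qed.
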